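(* Let $K$ be a field and let $G_1 \le S_6$ be the subgroup of order 72 generated by $(1\,2\,3)$, $(1\,4)(2\,5)(3\,6)$ and $(1\,2)$. Let $t_1,\dots,t_5$ be independent variables over $K$. (i) If $\operatorname{char}(K)=2$, then the polynomial $$X^6 + X^5 + (t_1+t_3) X^4 + (t_2+t_4) X^3 + (t_5 + t_3 t_1^2 + t_1 t_4 + t_4^2) X^2 + (t_1 t_5 + t_4 t_2) X + (t_3 t_2^2 + t_2 t_5 + t_5^2)$$ in $K(t_1,t_2,t_3,t_4,t_5)[X]$ is a generic polynomial for $G_1$ over $K$. (ii) If $\operatorname{char}(K)\neq 2$, then the polynomial $$X^6 - 2 X^5 + (2 t_1 + t_3 + 1) X^4 - (2 t_2 + 2 t_4) X^3 + \Big(2 t_5 + t_1^2 + \frac{(t_1 - t_4)^2}{t_3}\Big) X^2 - 2\Big(t_1 t_2 + \frac{(t_1 - t_4)(t_2 - t_5)}{t_3}\Big) X + \Big(t_2^2 + \frac{(t_2 - t_5)^2}{t_3}\Big)$$ in $K(t_1,t_2,t_3,t_4,t_5)[X]$ is a generic polynomial for $G_1$ over $K$.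
   Context: Let $K$ be a field and $G$ a finite group. A monic separable polynomial $g(t_1,\dots,t_m;X)\in K(t_1,\dots,t_m)[X]$, with $t_1,\dots,t_m$ independent variables over $K$, is called generic for $G$ over $K$ if: (1) the Galois group of $g$, viewed as a polynomial in $X$ over $K(t_1,\dots,t_m)$, is isomorphic to $G$; and (2) for every infinite field $L$ containing $K$ and every Galois field extension $N/L$ with Galois group isomorphic to $G$, there exist $\lambda_1,\dots,\lambda_m\in L$ (at which no denominator of a coefficient of $g$ vanishes) such that $N$ is the splitting field of $g(\lambda_1,\dots,\lambda_m;X)$ over $L$. *)

(* Defs.v *)
From HB Require Import structures.
From mathcomp Require Import all_boot all_order all_algebra all_fingroup.
From mathcomp Require Import all_solvable all_field.
From mathcomp Require Import mpoly.

Set Implicit Arguments.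
Unset Strict Implicit.
Unset Printing Implicit Defensive.

Import GRing.Theory.
Local Open Scope ring_scope.

(* The field K(t_1, ..., t_m). *)
Notation ratfun K m := {fraction {mpoly K[m]}}.

Definition infinite_field (L : fieldType) : Prop :=
  forall s : seq L, exists x, x \notin s.

(* Splitting fields of p over F are unique up to F-isomorphism, so the choice
   of N is irrelevant. *)
Definition has_galois_group (F : fieldType) (p : {poly F})
    (gT : finGroupType) (G : {group gT}) : Prop :=
  exists N : splittingFieldType F,
    splittingFieldFor 1%VS (map_poly (in_alg N) p) {:N}%VS
    /\ 'Gal({:N} / 1%VS)%g \isog G.

(* f is defined at lam and takes the value v there.  The canonical
   representative of an element of {fraction _} need not be in lowest terms, so
   we ask for some representation whose denominator does not vanish at lam;
   by unique factorisation such a representation exists iff the denominator of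
   the reduced form of f does not vanish at lam, and v does not depend on it. *)
Definition value_at (K L : fieldType) (iota : {rmorphism K -> L}) (m : nat)
    (lam : 'I_m -> L) (f : ratfun K m) (v : L) : Prop :=
  exists a b : {mpoly K[m]},
    [/\ mmap iota lam b != 0,
        f = tofrac a / tofrac b
      & v = mmap iota lam a / mmap iota lam b].

(* No denominator of a coefficient of g vanishes at lam, and
   h = g(lam_1, ..., lam_m; X). *)
Definition specializes_to (K L : fieldType) (iota : {rmorphism K -> L})
    (m : nat) (g : {poly ratfun K m}) (lam : 'I_m -> L) (h : {poly L}) : Prop :=
  forall i : nat, value_at iota lam g`_i h`_i.

(* A field L containing K is a field L with a morphism iota : K -> L. *)
Definition generic_polynomial (K : fieldType) (m : nat)
    (g : {poly ratfun K m}) (gT : finGroupType) (G : {group gT}) : Prop :=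
  [/\ g \is monic,
      separable_poly g,
      has_galois_group g G
    & forall (L : fieldType) (iota : {rmorphism K -> L}),
        infinite_field L ->
        forall N : splittingFieldType L,
          galois 1%VS {:N}%VS ->
          'Gal({:N} / 1%VS)%g \isog G ->
          exists (lam : 'I_m -> L) (h : {poly L}),
            specializes_to iota g lam h
            /\ splittingFieldFor 1%VS (map_poly (in_alg N) h) {:N}%VS].

(* The points 1, ..., 6 permuted by S_6 are the ordinals 0, ..., 5. *)
Definition pt (k : nat) : 'I_6 := inord k.-1.

(* Permutations compose from left to right, so the first generator is the
   cycle 1 -> 2 -> 3 -> 1. *)
Definition G1 : {group 'S_6} :=
  <<[set (tperm (pt 1) (pt 2) * tperm (pt 1) (pt 3))%g;
         (tperm (pt 1) (pt 4) * tperm (pt 2) (pt 5) * tperm (pt 3) (pt 6))%g;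
         tperm (pt 1) (pt 2)]>>%G.

(* The variables t_1, ..., t_5 are 'X_0, ..., 'X_4. *)
Definition tvar (K : fieldType) (k : nat) : ratfun K 5 :=
  tofrac ('X_(inord k.-1) : {mpoly K[5]}).

Definition poly_char2 (K : fieldType) : {poly ratfun K 5} :=
  let t1 := tvar K 1 in let t2 := tvar K 2 in let t3 := tvar K 3 in
  let t4 := tvar K 4 in let t5 := tvar K 5 in
  'X^6 + 'X^5
  + (t1 + t3) *: 'X^4
  + (t2 + t4) *: 'X^3
  + (t5 + t3 * t1 ^+ 2 + t1 * t4 + t4 ^+ 2) *: 'X^2
  + (t1 * t5 + t4 * t2) *: 'X
  + (t3 * t2 ^+ 2 + t2 * t5 + t5 ^+ 2)%:P.

Definition poly_char_neq2 (K : fieldType) : {poly ratfun K 5} :=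
  let t1 := tvar K 1 in let t2 := tvar K 2 in let t3 := tvar K 3 in
  let t4 := tvar K 4 in let t5 := tvar K 5 in
  'X^6
  - 2 *: 'X^5
  + (2 * t1 + t3 + 1) *: 'X^4
  - (2 * t2 + 2 * t4) *: 'X^3
  + (2 * t5 + t1 ^+ 2 + (t1 - t4) ^+ 2 / t3) *: 'X^2
  - (2 * (t1 * t2 + (t1 - t4) * (t2 - t5) / t3)) *: 'X
  + (t2 ^+ 2 + (t2 - t5) ^+ 2 / t3)%:P.

(* Main.v *)
Require Import Defs.
From HB Require Import structures.
From mathcomp Require Import all_boot all_order all_algebra all_fingroup.
From mathcomp Require Import all_solvable all_field.
From mathcomp Require Import mpoly.
From Stdlib Require Import Classical.
From mathcomp Require Import ring.

Set Implicit Arguments.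
Unset Strict Implicit.
Unset Printing Implicit Defensive.

Import GRing.Theory.
Local Open Scope ring_scope.

(** The group G_1 is the wreath product of S_3 by C_2: it consists of the
    permutations of the six points that preserve the partition into the blocks
    1,2,3 and 4,5,6 (G1E).  A sextic with such a group splits over a quadratic
    extension into two conjugate cubics, which have the form

      f_b = X^3 - theta_b X^2 + (a theta_b + b) X - (c theta_b + d),

    when the sum theta_b of the roots in the block b generates this extension.
    The roots can be chosen so that this holds and the trace T of theta is any
    prescribed nonzero constant.  With n the norm of theta, the
    product of the two cubics is a polynomial wreath_poly T (n, a, b, c, d)
    whose coefficients are polynomials in the five parameters.  Both
    polynomials of the theorem have this shape, with T = 1 in characteristic 2
    and T = 2 otherwise, up to a birational change q, tau between the parameters
    (n, a, b, c, d) and the variables t_i, defined as long as the discriminant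
    T^2 - 4n is nonzero.  Hence everything follows from wreath_poly_generic,
    whose proof has two halves.

    The Galois group over K(t).  Take E = K(x_0, ..., x_5), where the only
    relation is that the sum of the x_i is T; as T is nonzero, the x_i are
    linearly independent over K (gen_root_free).  The values of the t_i at the
    x_i are algebraically independent (gen_t_indep): a polynomial relation P
    between them may be evaluated at the roots of the polynomial over an
    extension of K(t), where the t_i take their own values, so that P = 0.
    Thus K(t) embeds into E, and K(t)(x_0, ..., x_5) is a splitting field in E.
    Permuting the x_i by an element of G_1 fixes the t_i, so G_1 acts on this
    splitting field.  Conversely an automorphism over K(t) permutes the two
    roots theta_b of a quadratic polynomial over K(t); by linear independence
    of the x_i it preserves the blocks (generic_has_galois_group).

    Genericity.  Let N/L be Galois with group G_1.  Roots al_i that are permuted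
    as the six points and satisfy theta_true + theta_false = T are sums of
    conjugates of elements of N, found by linear independence of automorphisms
    (conjugate_pair, block_partition_of_unity).  The parameters of the sextic
    with roots al_i are fixed by the group, hence lie in L, and an automorphism
    that fixes every al_i is trivial, so these roots generate N (realize). *)

(** * Fields of fractions and evaluation of rational functions *)

Section FracLift.
Variables (R : idomainType) (S : fieldType) (f : {rmorphism R -> S}).
Hypothesis f_inj : injective f.

Lemma fracE (x : {fraction R}) :
  {ab : R * R | ab.2 != 0 & x = tofrac ab.1 / tofrac ab.2}.
Proof.
elim/quotW: x => r; exists (frac r); first exact: denom_ratioP.
unlock tofrac; rewrite -[X in _ * X]FracField.pi_inv -[RHS]FracField.pi_mul.
congr (\pi%qT _); rewrite /FracField.mulf /FracField.invf /=.
have d0 := denom_ratioP r.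
rewrite !numden_Ratio ?oner_neq0 //= ?numden_Ratio ?mul1r ?mulr1 ?oner_neq0 //.
by rewrite Ratio_numden.
Qed.

(** The universal property of the field of fractions. *)
Lemma frac_lift :
  {g : {rmorphism {fraction R} -> S} | forall a, g (tofrac a) = f a}.
Proof.
have f_eq0 a : (f a == 0) = (a == 0) by rewrite -(inj_eq f_inj) rmorph0.
pose g x : S := let ab := s2val (fracE x) in f ab.1 / f ab.2.
have gE a b : b != 0 -> g (tofrac a / tofrac b) = f a / f b.
  move=> b0; rewrite /g; case: fracE => -[c d] /= d0 /eqP.
  rewrite eqr_div ?tofrac_eq0 // -!tofracM tofrac_eq => /eqP e.
  apply/eqP; rewrite eqr_div ?f_eq0 // -!rmorphM; apply/eqP; congr (f _).
  by rewrite e.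
have gT a : g (tofrac a) = f a.
  by rewrite -[tofrac a]divr1 -tofrac1 gE ?oner_neq0 // rmorph1 divr1.
have gB : zmod_morphism g.
  move=> x y; case: (fracE x) => -[a b] /= b0 ->; case: (fracE y) => -[c d] /= d0 ->.
  rewrite -mulNr addf_div ?tofrac_eq0 // -tofracN -!tofracM -tofracD.
  rewrite !gE ?mulf_neq0 //= -mulNr addf_div ?f_eq0 //.
  by rewrite rmorphD !rmorphM rmorphN.
have gM : monoid_morphism g.
  split=> [|x y]; first by rewrite -tofrac1 gT rmorph1.
  case: (fracE x) => -[a b] /= b0 ->; case: (fracE y) => -[c d] /= d0 ->.
  by rewrite mulf_div -!tofracM !gE ?mulf_neq0 // !rmorphM mulf_div.
pose gz := GRing.isZmodMorphism.Build _ _ g gB.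
pose gm := GRing.isMonoidMorphism.Build _ _ g gM.
pose gr : {rmorphism _ -> _} := HB.pack g gz gm.
by exists gr.
Qed.
End FracLift.

Lemma frac_morph_ext (R : idomainType) (S : fieldType)
    (g h : {rmorphism {fraction R} -> S}) :
  (forall a, g (tofrac a) = h (tofrac a)) -> g =1 h.
Proof.
by move=> gh x; have [[a b] /= _ ->] := fracE x; rewrite !fmorph_div !gh.
Qed.

Lemma mpoly_morph_ext (m : nat) (K : comNzRingType) (S : comNzRingType)
    (g h : {rmorphism {mpoly K[m]} -> S}) :
  (forall c, g c%:MP = h c%:MP) -> (forall i, g 'X_i = h 'X_i) -> g =1 h.
Proof.
move=> gC gX p; rewrite [p]mpolyE !rmorph_sum; apply: eq_bigr => u _.
rewrite -mul_mpolyC !rmorphM gC; congr (_ * _).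
rewrite mpolyXE_id !rmorph_prod; apply: eq_bigr => i _.
by rewrite !rmorphXn /= gX.
Qed.

Lemma morph_mmap (n : nat) (R : nzRingType) (A B : comNzRingType) (f : {rmorphism A -> B})
    (k : R -> A) (v : 'I_n -> A) p :
  f (mmap k v p) = mmap (f \o k) (f \o v) p.
Proof.
rewrite /mmap rmorph_sum; apply: eq_bigr => m _; rewrite rmorphM; congr (_ * _).
by rewrite /mmap1 rmorph_prod; apply: eq_bigr => i _; rewrite rmorphXn.
Qed.

Lemma eq_mmap (n : nat) (R : nzRingType) (A : comNzRingType)
    (k l : R -> A) (v w : 'I_n -> A) p :
  k =1 l -> v =1 w -> mmap k v p = mmap l w p.
Proof.
move=> kl vw; rewrite /mmap; apply: eq_bigr => m _; rewrite kl; congr (_ * _).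
by apply: eq_bigr => i _; rewrite vw.
Qed.

Section ValueAt.
Variables (K L : fieldType) (iota : {rmorphism K -> L}) (m : nat) (lam : 'I_m -> L).
Implicit Types (f g : ratfun K m) (u v : L).
Local Notation val f v := (value_at iota lam f v).

Lemma value_at_mpoly (p : {mpoly K[m]}) : val (tofrac p) (mmap iota lam p).
Proof.
by exists p, 1; rewrite !rmorph1 !divr1; split=> //; exact: oner_neq0.
Qed.

Lemma value_at_den (b : {mpoly K[m]}) : mmap iota lam b != 0 -> b != 0.
Proof. by apply: contraNneq => ->; rewrite rmorph0. Qed.

Lemma value_at_uniq f u v : val f u -> val f v -> u = v.
Proof.
move=> [a [b [nb -> ->]]] [c [d [nd /eqP e ->]]].
have nzb := value_at_den nb; have nzd := value_at_den nd.
move: e; rewrite eqr_div ?tofrac_eq0 // -!tofracM tofrac_eq => /eqP e.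
by apply/eqP; rewrite eqr_div // -!rmorphM e.
Qed.

Lemma value_atD f g u v : val f u -> val g v -> val (f + g) (u + v).
Proof.
move=> [a [b [nb -> ->]]] [c [d [nd -> ->]]].
exists (a * d + c * b), (b * d).
have nzb := value_at_den nb; have nzd := value_at_den nd.
by rewrite !rmorphD !rmorphM /= mulf_neq0 // !addf_div // ?tofrac_eq0.
Qed.

Lemma value_atM f g u v : val f u -> val g v -> val (f * g) (u * v).
Proof.
move=> [a [b [nb -> ->]]] [c [d [nd -> ->]]].
by exists (a * c), (b * d); rewrite !rmorphM /= mulf_neq0 // !mulf_div.
Qed.

Lemma value_atV f u : u != 0 -> val f u -> val f^-1 u^-1.
Proof.
move=> u0 [a [b [nb -> ub]]].
exists b, a; rewrite ub !invf_div; split=> //.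
by apply: contraNneq u0 => e; rewrite ub e mul0r.
Qed.

Lemma value_at_X i : val (tofrac 'X_i) (lam i).
Proof. by have := value_at_mpoly 'X_i; rewrite mmapX mmap1U. Qed.

Lemma value_at_C c : val (tofrac c%:MP) (iota c).
Proof. by have := value_at_mpoly c%:MP; rewrite mmapC. Qed.

Lemma value_at_nat k : val k%:R k%:R.
Proof. by have := value_at_mpoly k%:R; rewrite !rmorph_nat. Qed.

Lemma value_atN f u : val f u -> val (- f) (- u).
Proof.
move=> fu; rewrite -mulN1r -[- u]mulN1r; apply: value_atM => //.
by have := value_at_mpoly (-1); rewrite !rmorphN1.
Qed.

Lemma value_atB f g u v : val f u -> val g v -> val (f - g) (u - v).
Proof. by move=> fu /value_atN; apply: value_atD. Qed.

Lemma value_at_div f g u v : v != 0 -> val f u -> val g v -> val (f / g) (u / v).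
Proof. by move=> v0 fu /value_atV-/(_ v0); apply: value_atM. Qed.

Lemma value_at_sum (I : Type) (r : seq I) (P : pred I) (F : I -> ratfun K m) (u_ : I -> L) :
  (forall i, P i -> val (F i) (u_ i)) ->
  val (\sum_(i <- r | P i) F i) (\sum_(i <- r | P i) u_ i).
Proof.
move=> FU; elim/big_rec2: _ => [|i y1 y2 Pi]; first exact: value_at_nat 0.
exact/value_atD/FU.
Qed.

Lemma value_at_prod (I : Type) (r : seq I) (P : pred I) (F : I -> ratfun K m) (u_ : I -> L) :
  (forall i, P i -> val (F i) (u_ i)) ->
  val (\prod_(i <- r | P i) F i) (\prod_(i <- r | P i) u_ i).
Proof.
move=> FU; elim/big_rec2: _ => [|i y1 y2 Pi]; first exact: value_at_nat 1.
exact/value_atM/FU.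
Qed.

Lemma value_atX f u k : val f u -> val (f ^+ k) (u ^+ k).
Proof.
move=> fu; elim: k => [|k IH]; first exact: value_at_nat 1.
by rewrite !exprS; apply: value_atM.
Qed.

End ValueAt.

Lemma value_at_mmap (K L : fieldType) (iota : {rmorphism K -> L}) (m : nat)
    (lam : 'I_m -> L) (n : nat) (k : {rmorphism K -> ratfun K m})
    (F : 'I_n -> ratfun K m) (u : 'I_n -> L)
    (p : {mpoly K[n]}) :
  (forall c, k c = tofrac c%:MP) ->
  (forall i, value_at iota lam (F i) (u i)) ->
  value_at iota lam (mmap k F p) (mmap iota u p).
Proof.
move=> kE FU; rewrite /mmap; apply: value_at_sum => w _.
rewrite kE; apply: value_atM; first exact: value_at_C.
by apply: value_at_prod => i _; apply: value_atX.
Qed.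

Lemma value_at_morph (K L : fieldType) (iota : {rmorphism K -> L}) (m : nat)
    (lam : 'I_m -> L) (g : {rmorphism ratfun K m -> L}) f v :
  (forall p, g (tofrac p) = mmap iota lam p) ->
  value_at iota lam f v -> g f = v.
Proof. by move=> gE [a [b [nb -> ->]]]; rewrite fmorph_div !gE. Qed.

(** * Splitting fields inside a given field *)

(** Stated for a property P that passes from a product to one of the factors,
    such as being nonconstant or having a given root.  Irreducibility is not
    decidable over an abstract field, so the descent is classical. *)
Lemma irreducible_factor (F : fieldType) (P : {poly F} -> Prop) (p : {poly F}) :
  (forall q r, P (q * r) -> P q \/ P r) ->
  (forall q, q != 0 -> P q -> (size q > 1)%N) ->
  p != 0 -> P p -> exists q, [/\ irreducible_poly q, P q & q %| p].
Proof.
move=> PM Ps; have [n] := ubnP (size p); elim: n p => // n IH p sp p0 Pp.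
have [irr_p|] := classic (irreducible_poly p); first by exists p; split.
move=> /not_and_or[/(_ (Ps p p0 Pp))//|/not_all_ex_not[q nq]].
have [sq nq1] := imply_to_and _ _ nq.
have [/dvdpP[r pE] /negP nqp] := imply_to_and _ _ nq1.
have r0 : r != 0 by apply: contraNneq p0 => r0; rewrite pE r0 mul0r.
have q0 : q != 0 by apply: contraNneq p0 => q0; rewrite pE q0 mulr0.
have nr1 : size r != 1.
  apply: contra nqp => /size_poly1P[c c0 rc].
  by rewrite pE rc mul_polyC eqp_sym eqp_scale.
have sE : size p = (size r + size q).-1 by rewrite pE size_mul.
have sr0 : (0 < size r)%N by rewrite size_poly_gt0.
have sq0 : (0 < size q)%N by rewrite size_poly_gt0.
have sr2 : (1 < size r)%N by case: (size r) nr1 sr0 => [|[|]].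
have sq2 : (1 < size q)%N by case: (size q) sq sq0 => [|[|]].
have [rp qp] : r %| p /\ q %| p by rewrite pE dvdp_mulr ?dvdp_mull.
have [ltr ltq] : (size r < size p)%N /\ (size q < size p)%N.
  rewrite sE; case: (size r) sr2 => [|[|k]] // _.
  by case: (size q) sq2 => [|[|l]] // _; rewrite !addSn !addnS /= !ltnS leq_addr leq_addl.
move: (Pp); rewrite {1}pE => /PM[] Pq.
  have [|d [? ? dr]] := IH r _ r0 Pq; last by exists d; rewrite (dvdp_trans dr).
  exact: leq_trans ltr sp.
have [|d [? ? dr]] := IH q _ q0 Pq; last by exists d; rewrite (dvdp_trans dr).
exact: leq_trans ltq sp.
Qed.

Lemma exists_root (F : fieldType) (p : {poly F}) : (size p > 1)%N ->
  exists (M : fieldType) (i : {rmorphism F -> M}) (z : M), root (map_poly i p) z.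
Proof.
move=> sp; have p0 : p != 0 by rewrite -size_poly_gt0 ltnW.
pose P (q : {poly F}) := is_true (size q > 1)%N.
have PM q r : P (q * r) -> P q \/ P r.
  rewrite /P; have [->|q0] := eqVneq q 0; first by rewrite mul0r size_poly0.
  have [->|r0] := eqVneq r 0; first by rewrite mulr0 size_poly0.
  rewrite size_mul //; move: q0 r0; rewrite -!size_poly_gt0.
  by case: (size q) => [|[|?]] //; case: (size r) => [|[|?]] //; auto.
have [q [/irredp_FAdjoin[L _ [z rz _]] _ qp]] :=
  irreducible_factor PM (fun _ _ => id) p0 sp.
exists L, (in_alg L), z; move: rz; rewrite -!dvdp_XsubCl => /dvdp_trans; apply.
by rewrite dvdp_map.
Qed.

Lemma split_monic (F : fieldType) (p : {poly F}) : p \is monic ->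
  exists (M : fieldType) (i : {rmorphism F -> M}) (rs : seq M),
    map_poly i p = \prod_(z <- rs) ('X - z%:P).
Proof.
have [n] := ubnP (size p); elim: n F p => // n IH F p sp mp.
have [sp1|sp1] := leqP (size p) 1.
  exists F, idfun, [::]; rewrite big_nil map_poly_id //.
  by move: mp; rewrite (size1_polyC sp1) monicE lead_coefC => /eqP->.
have [M [i [z]]] := exists_root sp1.
move=> /factor_theorem[q pE].
have mq : q \is monic by rewrite -(monicMr q (monicXsubC z)) -pE ?monic_map ?monicXsubC.
have sq : (size q < n)%N.
  rewrite ltnS in sp; apply: leq_trans sp.
  rewrite -(size_map_poly i p) pE size_Mmonic ?monic_neq0 ?monicXsubC //.
  by rewrite size_XsubC addn2.
have [M' [i' [rs qE]]] := IH M q sq mq.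
exists M', (i' \o i), (i' z :: rs).
rewrite map_poly_comp pE rmorphM /= qE big_cons mulrC.
by rewrite rmorphB /= map_polyX map_polyC.
Qed.

(** The subfield F(rs) of E, as a finite extension N of F: adjoin the roots one
    at a time, each as a root of an irreducible polynomial over the field reached
    so far.  That N is generated by the roots is expressed by an induction
    principle, which passes through the change of base field more easily than
    an equality of subspaces. *)
Lemma generated_subfield (F E : fieldType) (j : {rmorphism F -> E}) (rs : seq E)
    (q : {poly F}) :
  q != 0 -> all (root (map_poly j q)) rs ->
  exists (N : fieldExtType F) (e : {rmorphism N -> E}) (as_ : seq N),
    [/\ forall c, e c%:A = j c, map e as_ = rs
      & forall P : N -> Prop, (forall c, P c%:A) ->
        (forall x y, P x -> P y -> P (x + y)) ->
        (forall x y, P x -> P y -> P (x * y)) ->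
        (forall x, x \in as_ -> P x) -> forall x, P x].
Proof.
elim: rs F j q => [|r rs IH] F j q q0 /=.
  move=> _; exists F^o, j, [::]; split=> // [c|P Pc _ _ _ x].
    by rewrite -mulr_algr mul1r; congr (j _); exact: mulr1.
  by have := Pc x; rewrite -[x%:A]/(x * 1) mulr1.
case/andP=> rr rrs.
pose P (u : {poly F}) := is_true (root (map_poly j u) r).
have PM u v : P (u * v) -> P u \/ P v.
  by rewrite /P rmorphM rootM => /orP.
have Ps u : u != 0 -> P u -> (size u > 1)%N.
  move=> u0 ru; rewrite -(size_map_poly j); apply: root_size_gt1 ru.
  by rewrite map_poly_eq0.
have [p [irr_p rp _]] := irreducible_factor PM Ps q0 rr.
have p0 := irredp_neq0 irr_p.
pose L : fieldExtType F := SubFieldExtType rp irr_p.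
pose jL : {rmorphism L -> E} := @subfx_inj _ _ j r p.
have jLE c : jL c%:A = j c by exact: subfx_inj_base.
have qL : map_poly jL (map_poly (in_alg L) q) = map_poly j q.
  by rewrite -map_poly_comp; apply: eq_map_poly => c /=; rewrite jLE.
have qL0 : map_poly (in_alg L) q != 0 by rewrite map_poly_eq0.
have rL : all (root (map_poly jL (map_poly (in_alg L) q))) rs by rewrite qL.
have [N [e [as_ [eE asE clN]]]] := IH L jL _ qL0 rL.
pose N0 := baseFieldType N.
pose z : L := @subfx_root _ _ j r p.
exists N0, e, ((in_alg N z) :: as_).
have N0E c : (c%:A : N0) = (c%:A : L)%:A by exact: baseField_scaleE.
split=> [c||Q Qc QD QM Qas].
- by rewrite N0E eE jLE.
- by rewrite /= asE eE; congr (_ :: _); exact: subfx_inj_root.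
apply: clN => // [c|x asx]; last by apply: Qas; rewrite inE asx orbT.
have [u ->] := subfxEroot rp p0 c.
rewrite -[_%:A]/(in_alg N _) -horner_map -map_poly_comp.
rewrite horner_coef; elim/big_ind: _ => [|//|i _].
  by have := Qc 0; rewrite scale0r.
rewrite coef_map; apply: (QM _ _); first exact: Qc.
elim: (val i) => [|k IHk]; first by have := Qc 1; rewrite scale1r.
by rewrite exprS; apply: QM => //; apply: Qas; rewrite mem_head.
Qed.

Lemma generated_full (F : fieldType) (N : fieldExtType F) (n : nat) (al : 'I_n -> N) :
  (forall P : N -> Prop, (forall c, P c%:A) ->
        (forall x y, P x -> P y -> P (x + y)) ->
        (forall x y, P x -> P y -> P (x * y)) ->
        (forall i, P (al i)) -> forall x, P x) ->
  <<1 & [seq al i | i <- enum 'I_n]>>%VS = {:N}%VS.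
Proof.
move=> cl; apply/eqP; rewrite eqEsubv subvf; apply/subvP => y _; move: y.
apply: cl => [c|y z|y z|i]; [|exact: rpredD|exact: rpredM|].
  by rewrite rpredZ // rpred1.
by apply: seqv_sub_adjoin; rewrite map_f ?mem_enum.
Qed.

(** The subfield of E generated by the roots of g is a splitting field of g. *)
Lemma splitting_subfield (F E : fieldType) (j : {rmorphism F -> E}) (n : nat)
    (x : 'I_n -> E) (g : {poly F}) :
  map_poly j g = \prod_i ('X - (x i)%:P) ->
  exists (N : splittingFieldType F) (e : {rmorphism N -> E}) (al : 'I_n -> N),
    [/\ forall c, e c%:A = j c, forall i, e (al i) = x i,
       map_poly (in_alg N) g = \prod_i ('X - (al i)%:P)
     & forall P : N -> Prop, (forall c, P c%:A) ->
        (forall x y, P x -> P y -> P (x + y)) ->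
        (forall x y, P x -> P y -> P (x * y)) ->
        (forall i, P (al i)) -> forall x, P x].
Proof.
move=> gE; pose rs := [seq x i | i <- enum 'I_n].
have g0 : g != 0.
  by rewrite -(map_poly_eq0 j) gE; apply/monic_neq0/monic_prod_XsubC.
have rg : all (root (map_poly j g)) rs.
  apply/allP => _ /mapP[i _ ->]; rewrite gE -[index_enum _]enumT.
  by rewrite -(big_map x xpredT (fun z => 'X - z%:P)) root_prod_XsubC map_f ?mem_enum.
have [N0 [e [as_ [eE asE clN]]]] := generated_subfield g0 rg.
pose al (i : 'I_n) : N0 := nth 0 as_ i.
have sas : size as_ = n by rewrite -(size_map e) asE size_map size_enum_ord.
have eal i : e (al i) = x i.
  rewrite /al -(nth_map 0 0) ?sas // asE (nth_map i) ?size_enum_ord //.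
  by rewrite nth_ord_enum.
have alP y : y \in as_ -> exists i, y = al i.
  move=> /(nthP 0)[k]; rewrite sas => lk <-; by exists (Ordinal lk).
have gN : map_poly (in_alg N0) g = \prod_i ('X - (al i)%:P).
  apply: (map_poly_inj e); rewrite -map_poly_comp.
  rewrite (eq_map_poly (g := j)) ?gE => [|c]; last exact: eE.
  rewrite rmorph_prod; apply: eq_bigr => i _.
  by rewrite rmorphB /= map_polyX map_polyC /= eal.
have cl (P : N0 -> Prop) : (forall c, P c%:A) ->
    (forall x y, P x -> P y -> P (x + y)) ->
    (forall x y, P x -> P y -> P (x * y)) ->
    (forall i, P (al i)) -> forall x, P x.
  by move=> Pc PD PM Pal; apply: clN => // y /alP[i ->].
have axN : SplittingField.axiom N0.
  exists (map_poly (in_alg N0) g).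
    by apply/polyOverP => i; rewrite coef_map /= rpredZ // rpred1.
  exists [seq al i | i <- enum 'I_n]; first by rewrite gN big_map enumT eqpxx.
  exact: generated_full cl.
pose N : splittingFieldType F := HB.pack N0 (FieldExt_isSplittingField.Build F N0 axN).
by exists N, e, al.
Qed.

(** An endomorphism of the ambient field that fixes F and stabilises N restricts
    to an element of the Galois group of N over F. *)
Lemma extend_to_gal (F E : fieldType) (N : splittingFieldType F) (e : {rmorphism N -> E})
    (phi : {rmorphism E -> E}) :
  (forall c : F, phi (e c%:A) = e c%:A) -> (forall y, exists z, phi (e y) = e z) ->
  exists2 sg : gal_of {:N}, sg \in 'Gal({:N} / 1%VS)%g & forall y, e (sg y) = phi (e y).
Proof.
move=> phic ex; have ex' y : exists z, phi (e y) == e z.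
  by have [z ->] := ex y; exists z.
pose psi y := xchoose (ex' y).
have psiE y : e (psi y) = phi (e y) by apply/esym/eqP/(xchooseP (ex' y)).
have inje := fmorph_inj e.
have psiB : zmod_morphism psi.
  by move=> y z; apply: inje; rewrite !(psiE, rmorphB).
have psiZ : scalable psi.
  move=> c y; apply: inje; rewrite psiE -mulr_algl -[RHS](congr1 e (mulr_algl _ _)).
  by rewrite !rmorphM phic psiE.
pose za := GRing.isZmodMorphism.Build _ _ psi psiB.
pose zs := GRing.isScalable.Build _ _ _ _ psi psiZ.
pose psil : {linear N -> N} := HB.pack psi za zs.
have psiH : kHom 1 {:N} (linfun psil).
  apply/kHom_lrmorphism; split=> [y z|]; rewrite !lfunE /=; apply: inje.
    by rewrite !(psiE, rmorphM).
  by rewrite psiE !rmorph1.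
have [|sg sgG sgE] := kHom_to_gal _ (normalFieldf 1) psiH; first by rewrite sub1v subvf.
by exists sg => // y; rewrite -sgE ?memvf // lfunE /= psiE.
Qed.

(** * The group of permutations preserving the two blocks *)

(** The block of a point: true for the points 1, 2, 3 of the first block, that
    is the ordinals 0, 1, 2. *)
Definition blk (i : 'I_6) : bool := (i < 3)%N.

Lemma blk0 : blk ord0 = true. Proof. by []. Qed.

(** For a permutation that preserves the partition into blocks, whether it
    exchanges them; the image of one point decides. *)
Definition swaps (s : 'S_6) : bool := ~~ blk (s ord0).

Definition block_perm (s : 'S_6) : bool :=
  [forall i, blk (s i) == blk i (+) swaps s].

Lemma block_permP (s : 'S_6) :
  reflect (exists b, forall i, blk (s i) = blk i (+) b) (block_perm s).
Proof.
apply: (iffP forallP) => [H|[b H] i]; first by exists (swaps s) => i; exact: eqP (H i).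
by rewrite /swaps !H blk0 addTb negbK eqxx.
Qed.

Lemma blk_perm s i : block_perm s -> blk (s i) = blk i (+) swaps s.
Proof. by move/forallP/(_ i)/eqP. Qed.

Definition block_perms := [set s | block_perm s].

Lemma block_perms_group : group_set block_perms.
Proof.
apply/group_setP; split=> [|s t].
  by rewrite inE; apply/block_permP; exists false => i; rewrite perm1 addbF.
rewrite !inE => /block_permP[b Hs] /block_permP[c Ht]; apply/block_permP.
by exists (b (+) c) => i; rewrite permM Ht Hs addbA.
Qed.

(** A permutation that preserves the fibers of f is a product of transpositions
    inside the fibers: composing s with the transposition of x and s x fixes x
    and every fixed point of s. *)
Lemma fiber_tperms_gen (T : finType) (I : eqType) (f : T -> I)
    (H : {group {perm T}}) (s : {perm T}) :
  (forall x y, f x = f y -> tperm x y \in H) -> (forall x, f (s x) = f x) ->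
  s \in H.
Proof.
move=> fH; have [n] := ubnP #|[pred x | s x != x]|; elim: n s => // n IH s sn fs.
have [/forallP s1|] := boolP [forall x, s x == x].
  have -> : s = 1%g by apply/permP => x; rewrite perm1; apply/eqP.
  exact: group1.
rewrite negb_forall => /existsP[x sx].
have -> : s = (s * tperm x (s x) * tperm x (s x))%g by rewrite -mulgA tperm2 mulg1.
apply: groupM; last by apply: fH; rewrite fs.
apply: IH => [|y]; last first.
  by rewrite permM; case: tpermP => [e|e|_ _] //; [rewrite fs -e | rewrite -(fs x) -e].
rewrite ltnS in sn; apply: leq_trans sn.
apply: proper_card; apply/properP; split; last first.
  by exists x; rewrite !inE ?permM ?tpermR ?eqxx.
apply/subsetP => y; rewrite !inE permM; apply: contra => /eqP sy; rewrite sy.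
have yx : x != y by apply: contraNneq sx => ->; rewrite sy.
have ysx : s x != y by apply: contraNneq yx => e; apply/eqP/(@perm_inj _ s); rewrite sy.
by rewrite tpermD.
Qed.

Lemma ptE k (lt_k : (k < 6)%N) : pt k.+1 = Ordinal lt_k.
Proof. by apply: val_inj; rewrite /= inordK. Qed.

Definition swap_blocks : 'S_6 :=
  (tperm (pt 1) (pt 4) * tperm (pt 2) (pt 5) * tperm (pt 3) (pt 6))%g.

Lemma swap_blocksE i : swap_blocks i = inord ((i + 3) %% 6).
Proof.
rewrite /swap_blocks !ptE !permM; apply: val_inj.
by case: i; do 6?[case=> //]; move=> ?; rewrite !permE /= inordK //.
Qed.

Lemma blk_swap_blocks i : blk (swap_blocks i) = ~~ blk i.
Proof.
rewrite swap_blocksE /blk inordK ?ltn_mod //.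
by case: i; do 6?[case=> //].
Qed.

Lemma blk_tperm x y i : blk x = blk y -> blk (tperm x y i) = blk i.
Proof. by move=> xy; case: tpermP => [->|->|]. Qed.

Lemma G1_gens :
  [/\ tperm (pt 1) (pt 2) \in G1, tperm (pt 1) (pt 3) \in G1 & swap_blocks \in G1].
Proof.
have g3 : tperm (pt 1) (pt 2) \in G1 by rewrite mem_gen // !inE eqxx ?orbT.
split=> //; last by rewrite mem_gen // !inE eqxx ?orbT.
rewrite -(groupMl _ g3) mem_gen //.
by rewrite !inE eqxx.
Qed.

(** The generators give the transpositions inside the first block; conjugating
    them by the exchange of the blocks gives those inside the second. *)
Lemma tperm_G1 x y : blk x = blk y -> tperm x y \in G1.
Proof.
have [g12 g13 gs] := G1_gens.
pose P i j := tperm (inord i) (inord j : 'I_6) \in G1.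
have P12 : P 1 2 by have := groupJ g13 g12; rewrite tpermJ tpermL tpermD ?ptE // /P -!ptE.
have PJ i j : (i < 3)%N -> (j < 3)%N -> P i j -> P (i + 3) (j + 3).
  move=> i3 j3 Pij; have := groupJ Pij gs; rewrite tpermJ !swap_blocksE.
  have H k : (k < 3)%N -> ((k + 3) %% 6)%N = (k + 3)%N.
    by rewrite -(ltn_add2r 3); apply: modn_small.
  by rewrite !inordK ?H //; exact: leq_trans (isT : 3 <= 6)%N.
have [[P45 P46] P56] := (PJ 0 1 isT isT g12, PJ 0 2 isT isT g13, PJ 1 2 isT isT P12).
have PC i j : P i j -> P j i by rewrite /P tpermC.
suff H i j : (i < 6)%N -> (j < 6)%N -> (i < 3)%N = (j < 3)%N -> P i j.
  by move=> xy; have := H x y (ltn_ord x) (ltn_ord y) xy; rewrite /P !inord_val.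
do 6?[case: i => [|i] //]; do 6?[case: j => [|j] //];
  by [rewrite /P tperm1 group1 | auto | move=> *; apply: PC].
Qed.

Lemma G1E s : (s \in G1) = block_perm s.
Proof.
apply/idP/idP => [|bs].
  suff /subsetP H : G1 \subset block_perms by move/H; rewrite inE.
  rewrite (gen_subG _ (group block_perms_group)).
  apply/subsetP => t /setUP[/setUP[]|] /set1P->; rewrite inE; apply/block_permP.
  - by exists false => i; rewrite addbF !permM !blk_tperm // !ptE.
  - by exists true => i; rewrite addbT blk_swap_blocks.
  - by exists false => i; rewrite addbF blk_tperm // !ptE.
have [_ _ gs] := G1_gens.
have nsw t : block_perm t -> ~~ swaps t -> t \in G1.
  move=> bt nt; apply: (fiber_tperms_gen (f := blk)) => [x y|x]; first exact: tperm_G1.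
  by rewrite blk_perm // (negbTE nt) addbF.
have [ss|] := boolP (swaps s); last exact: nsw.
rewrite -(groupMr _ gs); apply: nsw.
  apply/block_permP; exists false => i; rewrite permM blk_swap_blocks blk_perm //.
  by rewrite ss addbT negbK addbF.
by rewrite /swaps permM blk_swap_blocks negbK.
Qed.

Lemma swap_blocks_G1 : swap_blocks \in G1.
Proof. by have [] := G1_gens. Qed.

(** Double transitivity on a block: transpositions inside a block, preceded by
    the exchange of the blocks if needed, move the first two points anywhere. *)
Lemma G1_2trans i j : i != j -> blk i = blk j ->
  exists2 s, s \in G1 & s ord0 = i /\ s (inord 1) = j.
Proof.
move=> ij bij.
have [u uG bu] : exists2 u, u \in G1 & blk (u ord0) = blk i.
  have [bi|nbi] := boolP (blk i); first by exists 1%g; rewrite ?group1 ?perm1.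
  by exists swap_blocks; rewrite ?swap_blocks_G1 ?blk_swap_blocks.
have b1 : blk (inord 1) = blk ord0 by rewrite /blk inordK.
pose v := (u * tperm (u ord0) i)%g.
have vG : v \in G1 by rewrite groupM ?tperm_G1.
have v0 : v ord0 = i by rewrite permM tpermL.
have bv : blk (v (inord 1)) = blk j.
  by rewrite blk_perm -?G1E // b1 -blk_perm -?G1E // v0.
exists (v * tperm (v (inord 1)) j)%g; first by rewrite groupM ?tperm_G1.
have nvi : v (inord 1) != i.
  by rewrite -v0 (inj_eq perm_inj) -val_eqE /= inordK.
by rewrite ![(v * _)%g _]permM tpermL v0 tpermD // eq_sym.
Qed.

(** * Products of two conjugate cubics *)

(** The coefficients, from degree 0 to 6, of the product of the two cubics
    X^3 - theta X^2 + (a theta + b) X - (c theta + d) attached to the two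
    elements theta of trace T and norm n. *)
Definition wreath_coefs (R : pzRingType) (T n a b c d : R) : seq R :=
  [:: c ^+ 2 * n + c * d * T + d ^+ 2;
      - (2 * a * c * n + (a * d + b * c) * T + 2 * b * d);
      2 * c * n + d * T + (a ^+ 2 * n + a * b * T + b ^+ 2);
      - (T * c + 2 * d + 2 * a * n + b * T);
      n + T * a + 2 * b;
      - T;
      1].

Definition wreath_poly (R : nzRingType) (T : R) (v : 'I_5 -> R) : {poly R} :=
  Poly (wreath_coefs T (v (inord 0)) (v (inord 1)) (v (inord 2)) (v (inord 3)) (v (inord 4))).

Lemma map_wreath_poly (R S : nzRingType) (f : {rmorphism R -> S}) T v :
  map_poly f (wreath_poly T v) = wreath_poly (f T) (f \o v).
Proof.
apply/polyP => i; rewrite coef_map !coef_Poly /wreath_coefs /=.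
by do 7?[case: i => [|i] /=];
  rewrite ?nth_nil ?(rmorphD, rmorphN, rmorphM, rmorphXn, rmorph1, rmorph_nat, rmorph0).
Qed.

Lemma wreath_poly_ext (R : nzRingType) (T : R) v w :
  v =1 w -> wreath_poly T v = wreath_poly T w.
Proof. by move=> vw; rewrite /wreath_poly !vw. Qed.

Lemma wreath_poly_monic (R : nzRingType) (T : R) v : wreath_poly T v \is monic.
Proof.
rewrite /wreath_poly monicE lead_coefE (PolyK (c := 0)) /= ?oner_neq0 //.
Qed.

Definition vec5 (R : nmodType) (n a b c d : R) (k : 'I_5) : R := [:: n; a; b; c; d]`_k.

Lemma vec5E (R : nmodType) (v : 'I_5 -> R) :
  v =1 vec5 (v (inord 0)) (v (inord 1)) (v (inord 2)) (v (inord 3)) (v (inord 4)).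
Proof.
move=> k; rewrite -{1}[k]inord_val /vec5; case: k => k /=.
by do 5?[case: k => [|k] //].
Qed.

Definition param_cubic (R : comNzRingType) (theta : R) (v : 'I_5 -> R) : {poly R} :=
  'X^3 - theta *: 'X^2 + (v (inord 1) * theta + v (inord 2)) *: 'X
  - (v (inord 3) * theta + v (inord 4))%:P.

Lemma wreath_poly_factor (R : comNzRingType) (T theta theta' : R) v :
  theta + theta' = T -> theta * theta' = v (inord 0) ->
  param_cubic theta v * param_cubic theta' v = wreath_poly T v.
Proof.
move=> eT en.
rewrite /param_cubic /wreath_poly /wreath_coefs /= -eT -en.
move: (v _) (v _) (v _) (v _) => a b c d.
rewrite !cons_poly_def -!mul_polyC.
rewrite !(polyCD, polyCN, polyCM, polyCB, rmorphXn, polyC1, polyC0, polyC_natr) /=.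
ring.
Qed.

Section Roots.
Variables (M : fieldType) (xi : 'I_6 -> M).

Definition block_cubic b : {poly M} := \prod_(i | blk i == b) ('X - (xi i)%:P).
Definition theta b : M := - (block_cubic b)`_2.
Definition param_a :=
  ((block_cubic true)`_1 - (block_cubic false)`_1) / (theta true - theta false).
Definition param_c :=
  - ((block_cubic true)`_0 - (block_cubic false)`_0) / (theta true - theta false).
(** The parameters (n, a, b, c, d) of the sextic with roots xi: its two cubic
    factors have conjugate coefficients, which are expressed on the basis
    theta, 1.  They are meaningful when the two values of theta differ. *)
Definition params : 'I_5 -> M :=
  vec5 (theta true * theta false) param_a ((block_cubic true)`_1 - param_a * theta true)
       param_c (- (block_cubic true)`_0 - param_c * theta true).

Lemma card_block b : #|[pred i | blk i == b]| = 3.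
Proof.
by rewrite -sum1_card big_mkcond /= !big_ord_recl big_ord0; case: b.
Qed.

Lemma block_cubic_enum b :
  block_cubic b = \prod_(i <- enum [pred i | blk i == b]) ('X - (xi i)%:P).
Proof. by rewrite /block_cubic big_enum. Qed.

Lemma size_block_cubic b : size (block_cubic b) = 4.
Proof. by rewrite block_cubic_enum size_prod_XsubC -cardE card_block. Qed.

Lemma block_cubic_monic b : block_cubic b \is monic.
Proof. exact: monic_prod_XsubC. Qed.

Lemma theta_sum b : theta b = \sum_(i | blk i == b) xi i.
Proof.
rewrite /theta block_cubic_enum -(big_map xi xpredT (fun z => 'X - z%:P)).
set ps := map _ _; have sz : size ps = 3 by rewrite size_map -cardE card_block.
have := coefPn_prod_XsubC (ps := ps); rewrite sz => -> //.
by rewrite opprK /ps big_map big_enum.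
Qed.

Hypothesis theta_neq : theta true != theta false.

Lemma param_a_theta b :
  param_a * theta b + ((block_cubic true)`_1 - param_a * theta true) = (block_cubic b)`_1.
Proof.
have d0 : theta true - theta false != 0 by rewrite subr_eq0.
by case: b; [ring | rewrite /param_a; field].
Qed.

Lemma param_c_theta b :
  param_c * theta b + (- (block_cubic true)`_0 - param_c * theta true) = - (block_cubic b)`_0.
Proof.
have d0 : theta true - theta false != 0 by rewrite subr_eq0.
by case: b; [ring | rewrite /param_c; field].
Qed.

Lemma block_cubicE b : block_cubic b = param_cubic (theta b) params.
Proof.
rewrite /param_cubic /params /vec5 !inordK //= param_a_theta param_c_theta.
apply/polyP => i; rewrite !(coefB, coefD, coefZ, coefXn, coefX, coefC, coefN) /theta.
have mc : (block_cubic b)`_3 = 1.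
  by have /monicP := block_cubic_monic b; rewrite lead_coefE size_block_cubic.
do 4?[case: i => [|i] /=]; rewrite ?mc; try by ring.
rewrite nth_default ?size_block_cubic //; ring.
Qed.

Lemma prod_XsubC_wreath_poly :
  \prod_i ('X - (xi i)%:P) = wreath_poly (theta true + theta false) params.
Proof.
rewrite -(@wreath_poly_factor _ _ (theta true) (theta false)) ?/params /vec5 ?inordK //.
rewrite -!block_cubicE (bigID blk) /=; congr (_ * _); apply: eq_bigl => i; by case: (blk i).
Qed.

End Roots.

Lemma eq_params (M : fieldType) (xi xi' : 'I_6 -> M) : xi =1 xi' -> params xi =1 params xi'.
Proof.
move=> e; have cE b : block_cubic xi b = block_cubic xi' b by apply: eq_bigr => i _; rewrite e.
by move=> k; rewrite /params /param_a /param_c /theta !cE.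
Qed.

Section RootsMorph.
Variables (M : fieldType) (xi : 'I_6 -> M).

Lemma block_cubic_perm (s : 'S_6) b : block_perm s ->
  block_cubic (xi \o s) b = block_cubic xi (b (+) swaps s).
Proof.
move=> bs; rewrite /block_cubic [RHS](reindex_inj (@perm_inj _ s)) /=.
apply: eq_bigl => i; rewrite blk_perm //.
by case: (blk i) (swaps s) b => [] [] [].
Qed.

Lemma theta_perm (s : 'S_6) b : block_perm s -> theta (xi \o s) b = theta xi (b (+) swaps s).
Proof. by move=> bs; rewrite /theta block_cubic_perm. Qed.

(** Exchanging the blocks conjugates the two cubics, and the coordinates on the
    basis theta, 1 are invariant under conjugation. *)
Lemma params_perm (s : 'S_6) : theta xi true != theta xi false -> block_perm s ->
  params (xi \o s) =1 params xi.
Proof.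
move=> txi bs; rewrite /params /param_a /param_c !theta_perm // !block_cubic_perm //.
case: (swaps s) => //= k; rewrite /vec5.
have d0 : theta xi true - theta xi false != 0 by rewrite subr_eq0.
have d1 : theta xi false - theta xi true != 0 by rewrite subr_eq0 eq_sym.
case: k => k lt_k /=; do 5?[case: k lt_k => [|k] lt_k //=];
  by [rewrite mulrC | field; rewrite d0 d1].
Qed.

Lemma block_cubic_morph (M' : fieldType) (f : {rmorphism M -> M'}) b :
  block_cubic (f \o xi) b = map_poly f (block_cubic xi b).
Proof.
rewrite /block_cubic rmorph_prod; apply: eq_bigr => i _.
by rewrite rmorphB /= map_polyX map_polyC.
Qed.

Lemma theta_morph (M' : fieldType) (f : {rmorphism M -> M'}) b :
  theta (f \o xi) b = f (theta xi b).
Proof. by rewrite /theta block_cubic_morph coef_map rmorphN. Qed.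

Lemma params_morph (M' : fieldType) (f : {rmorphism M -> M'}) :
  params (f \o xi) =1 f \o params xi.
Proof.
move=> k; rewrite /params /param_a /param_c !theta_morph !block_cubic_morph !coef_map /vec5.
case: k => k lt_k /=; do 5?[case: k lt_k => [|k] lt_k //=];
  by rewrite ?(rmorphM, rmorphB, rmorphN, fmorphV, rmorphD).
Qed.

(** A converse of the definition of params: the coordinates of conjugate
    coefficients on the basis theta, 1 are unique. *)
Lemma params_unique (v : 'I_5 -> M) (t : bool -> M) :
  t true != t false -> t true * t false = v (inord 0) ->
  (forall b, block_cubic xi b = param_cubic (t b) v) ->
  (forall b, theta xi b = t b) /\ params xi =1 v.
Proof.
move=> nt en cE.
have c2 b : (block_cubic xi b)`_2 = - t b.
  rewrite cE /param_cubic.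
  by rewrite !(coefB, coefD, coefZ, coefXn, coefX, coefC, coefN) /=; ring.
have c1 b : (block_cubic xi b)`_1 = v (inord 1) * t b + v (inord 2).
  rewrite cE /param_cubic.
  by rewrite !(coefB, coefD, coefZ, coefXn, coefX, coefC, coefN) /=; ring.
have c0 b : (block_cubic xi b)`_0 = - (v (inord 3) * t b + v (inord 4)).
  rewrite cE /param_cubic.
  by rewrite !(coefB, coefD, coefZ, coefXn, coefX, coefC, coefN) /=; ring.
have tE b : theta xi b = t b by rewrite /theta c2 opprK.
split=> // k; rewrite [RHS]vec5E /params /param_a /param_c !tE !c1 !c0.
have d0 : t true - t false != 0 by rewrite subr_eq0.
rewrite /vec5; case: k => k lt_k /=; do 5?[case: k lt_k => [|k] lt_k //=];
  by field.
Qed.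

End RootsMorph.

Lemma value_at_params (K L : fieldType) (iota : {rmorphism K -> L}) (m : nat)
    (lam : 'I_m -> L) (x : 'I_6 -> ratfun K m) (xi : 'I_6 -> L) :
  (forall i, value_at iota lam (x i) (xi i)) -> theta xi true != theta xi false ->
  forall k, value_at iota lam (params x k) (params xi k).
Proof.
move=> xE txi.
have cE b k : value_at iota lam (block_cubic x b)`_k (block_cubic xi b)`_k.
  rewrite /block_cubic; move: k; elim/big_rec2: _ => [|i p q _ IH] k.
    by rewrite !coefC; case: eqP => _; [exact: value_at_nat 1 | exact: value_at_nat 0].
  rewrite !mulrBl !coefB !coefXM !coefCM; apply: value_atB.
    by case: eqP => _; [exact: value_at_nat 0 | exact: IH].
  exact: value_atM.
have tE b : value_at iota lam (theta x b) (theta xi b) by apply: value_atN.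
have d0 : theta xi true - theta xi false != 0 by rewrite subr_eq0.
have aE : value_at iota lam (param_a x) (param_a xi).
  by apply: value_at_div => //; apply: value_atB.
have ccE : value_at iota lam (param_c x) (param_c xi).
  by apply: value_at_div => //; [apply: value_atN|]; apply: value_atB.
rewrite /params /vec5 => -[k lt_k] /=; do 5?[case: k lt_k => [|k] lt_k //=].
- exact: value_atM.
- by apply: value_atB => //; apply: value_atM.
- by apply: value_atB; [apply: value_atN | apply: value_atM].
Qed.

Lemma value_at_wreath_poly (K L : fieldType) (iota : {rmorphism K -> L}) (m : nat)
    (lam : 'I_m -> L) (T : ratfun K m) (T' : L) F u :
  value_at iota lam T T' -> (forall k, value_at iota lam (F k) (u k)) ->
  specializes_to iota (wreath_poly T F) lam (wreath_poly T' u).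
Proof.
move=> TT FU i; rewrite /wreath_poly !coef_Poly /wreath_coefs.
have two := value_at_nat iota lam 2; have one := value_at_nat iota lam 1.
have zero := value_at_nat iota lam 0.
by do 7?[case: i => [|i] /=];
  repeat (apply: value_atD || apply: value_atN || apply: value_atM || apply: value_atX);
  rewrite ?nth_nil.
Qed.

(** * Roots of the product in an extension *)

Lemma block_cubic_split3 (M : fieldType) (rs1 rs2 : seq M) :
  size rs1 = 3 -> size rs2 = 3 ->
  let xi (i : 'I_6) := (rs1 ++ rs2)`_i in
  block_cubic xi true = \prod_(z <- rs1) ('X - z%:P) /\
  block_cubic xi false = \prod_(z <- rs2) ('X - z%:P).
Proof.
case: rs1 => [|a [|b [|c [|? ?]]]] // _; case: rs2 => [|d [|e [|f [|? ?]]]] // _ /=.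
rewrite /block_cubic !(big_mkcond (fun i => blk i == _)) /=.
rewrite !big_ord_recl !big_ord0 !big_cons !big_nil /=.
by rewrite !mulr1 !mul1r.
Qed.

Lemma size_param_cubic (R : comNzRingType) (t : R) v : size (param_cubic t v) = 4.
Proof.
rewrite /param_cubic -!addrA size_polyDl size_polyXn //.
rewrite (leq_ltn_trans (size_polyD _ _)) // gtn_max size_polyN.
rewrite (leq_ltn_trans (size_scale_leq _ _)) ?size_polyXn //=.
rewrite (leq_ltn_trans (size_polyD _ _)) // gtn_max size_polyN.
rewrite (leq_ltn_trans (size_scale_leq _ _)) ?size_polyX //=.
by rewrite (leq_ltn_trans (size_polyC_leq1 _)).
Qed.

Lemma param_cubic_monic (R : comNzRingType) (t : R) v : param_cubic t v \is monic.
Proof.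
rewrite monicE lead_coefE size_param_cubic.
by rewrite !(coefB, coefD, coefZ, coefXn, coefX, coefC, coefN) /= !(mulr0, subr0, addr0).
Qed.

Lemma map_param_cubic (R S : comNzRingType) (f : {rmorphism R -> S}) t v :
  map_poly f (param_cubic t v) = param_cubic (f t) (f \o v).
Proof.
rewrite /param_cubic !(rmorphB, rmorphD) /= !map_polyZ /= !map_polyXn map_polyX map_polyC /=.
by rewrite !(rmorphD, rmorphM) /= map_polyC.
Qed.

Definition quad (R : comNzRingType) (T n : R) : {poly R} := 'X^2 - T *: 'X + n%:P.

Lemma coef_quad (R : comNzRingType) (T n : R) :
  [/\ (quad T n)`_0 = n, (quad T n)`_1 = - T & size (quad T n) = 3].
Proof.
rewrite /quad !(coefB, coefD, coefZ, coefXn, coefX, coefC, coefN) /=.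
split; rewrite ?(mulr0, mulr1, subr0, sub0r, add0r, addr0) ?oppr0 ?add0r //.
rewrite -addrA size_polyDl size_polyXn //.
rewrite (leq_ltn_trans (size_polyD _ _)) // gtn_max size_polyN.
rewrite (leq_ltn_trans (size_scale_leq _ _)) ?size_polyX //=.
by rewrite (leq_ltn_trans (size_polyC_leq1 _)).
Qed.

Lemma quad_monic (R : comNzRingType) (T n : R) : quad T n \is monic.
Proof.
have [_ _ sp] := coef_quad T n; rewrite monicE lead_coefE sp /quad.
by rewrite !(coefB, coefD, coefZ, coefXn, coefX, coefC, coefN) /= !(mulr0, subr0, addr0).
Qed.

Lemma quad_factor (R : comNzRingType) (t u : R) :
  ('X - t%:P) * ('X - u%:P) = quad (t + u) (t * u).
Proof. by rewrite /quad -mul_polyC polyCD polyCM; ring. Qed.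

Lemma disc_theta (F : fieldType) (t u : F) : ((t + u) ^+ 2 - 4 * (t * u) != 0) = (t != u).
Proof.
have -> : (t + u) ^+ 2 - 4 * (t * u) = (t - u) ^+ 2 by ring.
by rewrite expf_eq0 /= subr_eq0.
Qed.

Lemma split_quad (F : fieldType) (T n : F) : T ^+ 2 - 4 * n != 0 ->
  exists (M : fieldType) (i : {rmorphism F -> M}) (t u : M),
    [/\ t != u, t + u = i T & t * u = i n].
Proof.
move=> disc; have [M [i [rs pE]]] := split_monic (quad_monic T n).
have [_ _ sp] := coef_quad T n.
have srs : size rs = 2.
  by apply: succn_inj; rewrite -(size_prod_XsubC rs id) -pE size_map_poly.
case: rs srs pE => [|t [|u [|? ?]]] // _; rewrite !big_cons big_nil mulr1.
rewrite quad_factor => pE.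
have [c0 c1 _] := coef_quad T n; have [d0 d1 _] := coef_quad (t + u) (t * u).
have eT : t + u = i T by apply: oppr_inj; rewrite -d1 -pE coef_map /= c1 rmorphN.
have en : t * u = i n by rewrite -d0 -pE coef_map /= c0.
exists M, i, t, u; split=> //; apply: contraNneq disc => tu.
rewrite -(fmorph_eq0 i) rmorphB rmorphXn rmorphM rmorph_nat /= -eT -en tu /=.
by apply/eqP; ring.
Qed.

(** First split the quadratic polynomial of theta, then the two cubics, so that
    the six roots come labelled by blocks. *)
Lemma wreath_poly_roots (F : fieldType) (T : F) (v : 'I_5 -> F) :
  T ^+ 2 - 4 * v (inord 0) != 0 ->
  exists (M : fieldType) (i : {rmorphism F -> M}) (xi : 'I_6 -> M),
    [/\ theta xi true != theta xi false, theta xi true + theta xi false = i T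
      & params xi =1 i \o v].
Proof.
move=> /split_quad[M1 [i1 [t [u [tu eT en]]]]].
have [M2 [i2 [rs1 E1]]] := split_monic (param_cubic_monic t (i1 \o v)).
have [M3 [i3 [rs2 E2]]] := split_monic (param_cubic_monic (i2 u) (i2 \o i1 \o v)).
have s1 : size (map i3 rs1) = 3.
  apply: succn_inj; rewrite size_map -(size_prod_XsubC rs1 id) -E1.
  by rewrite size_map_poly size_param_cubic.
have s2 : size rs2 = 3.
  by apply: succn_inj; rewrite -(size_prod_XsubC rs2 id) -E2 size_map_poly size_param_cubic.
have [C1 C2] := block_cubic_split3 s1 s2.
pose i := i3 \o i2 \o i1.
pose tt b := i3 (i2 (if b then t else u)).
have [|||tE vE] := @params_unique _ (fun i => (map i3 rs1 ++ rs2)`_i) (i \o v) tt.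
- by rewrite /tt !fmorph_eq.
- by rewrite /tt -!rmorphM en.
- case; rewrite ?C1 ?C2 -?E2 ?map_param_cubic //.
  rewrite big_map; transitivity (map_poly i3 (\prod_(z <- rs1) ('X - z%:P))).
    by rewrite rmorph_prod; apply: eq_bigr => z _; rewrite rmorphB /= map_polyX map_polyC.
  by rewrite -E1 !map_param_cubic.
exists M3, i, (fun i => (map i3 rs1 ++ rs2)`_i).
by split=> //; rewrite !tE /tt ?fmorph_eq // -!rmorphD eT.
Qed.

(** * The generic point *)

Definition ratfun_const (K : fieldType) (m : nat) : {rmorphism K -> ratfun K m} :=
  @FracField.tofrac {mpoly K[m]} \o @mpolyC m K.

Section GenericPoint.
Variables (K : fieldType) (T : K).
Hypothesis T_neq0 : T != 0.

(** Five of the six generic roots are the variables, and the last one is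
    determined by the condition that the six add up to T. *)
Definition gen_coord (i : 'I_6) : {mpoly K[5]} :=
  if unlift ord_max i is Some j then 'X_j else T%:MP - \sum_j 'X_j.

Lemma gen_coord_lift j : gen_coord (lift ord_max j) = 'X_j.
Proof. by rewrite /gen_coord liftK. Qed.

Lemma gen_coord_max : gen_coord ord_max = T%:MP - \sum_j 'X_j.
Proof. by rewrite /gen_coord unlift_none. Qed.

Lemma sum_gen_coord : \sum_i gen_coord i = T%:MP.
Proof.
rewrite (bigD1_ord ord_max) //= gen_coord_max.
by rewrite (eq_bigr _ (fun j _ => gen_coord_lift j)) subrK.
Qed.

(** The constant coefficient of a relation is c_5 T, whence c_5 = 0 as T is
    nonzero; the other coefficients are then read off the variables. *)
Lemma gen_coord_free (c : 'I_6 -> K) : \sum_i c i *: gen_coord i = 0 -> forall i, c i = 0.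
Proof.
rewrite (bigD1_ord ord_max) //= gen_coord_max.
under eq_bigr do rewrite gen_coord_lift.
move=> E.
have cm : c ord_max = 0.
  have := congr1 (mcoeff 0%MM) E; rewrite mcoeffD mcoeffZ mcoeffB mcoeffC eqxx mulr1.
  rewrite !raddf_sum /= !big1 ?subr0 ?addr0 ?mcoeff0.
  - by move/eqP; rewrite mulf_eq0 (negbTE T_neq0) orbF => /eqP.
  - by move=> j _; rewrite mcoeffZ mcoeffX mnm1_eq0 mulr0.
  - by move=> j _; rewrite mcoeffX mnm1_eq0 oppr0.
move=> i; have [j ->|->] := unliftP ord_max i; last by [].
have := congr1 (mcoeff U_(j)%MM) E; rewrite cm scale0r add0r mcoeff0 raddf_sum /=.
rewrite (bigD1 j) //= mcoeffZ mcoeffXU eqxx mulr1 big1 ?addr0 // => k kj.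
by rewrite mcoeffZ mcoeffXU (negbTE kj) mulr0.
Qed.

Definition gen_root (i : 'I_6) : ratfun K 5 := tofrac (gen_coord i).

Lemma gen_root_free (c : 'I_6 -> K) :
  \sum_i ratfun_const K 5 (c i) * gen_root i = 0 -> forall i, c i = 0.
Proof.
move=> H; apply: gen_coord_free; apply/eqP; rewrite -tofrac_eq0 rmorph_sum /=; apply/eqP.
by rewrite -[RHS]H; apply: eq_bigr => i _; rewrite -mul_mpolyC rmorphM.
Qed.

(** Linear independence over K, applied to the difference of the indicator
    functions of A and B. *)
Lemma gen_root_blocks (A B : {pred 'I_6}) :
  \sum_(i in A) gen_root i = \sum_(i in B) gen_root i -> A =i B.
Proof.
move=> AB i; pose c (k : 'I_6) : K := (k \in A)%:R - (k \in B)%:R.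
suff /gen_root_free/(_ i)/eqP : \sum_k ratfun_const K 5 (c k) * gen_root k = 0.
  rewrite /c subr_eq0; case: (i \in A) (i \in B) => [] [] //.
  - by rewrite oner_eq0.
  - by rewrite eq_sym oner_eq0.
under eq_bigr do rewrite rmorphB /= mulrBl.
rewrite sumrB; apply/eqP; rewrite subr_eq0; apply/eqP.
have S C : \sum_k tofrac (C k : bool)%:R%:MP * gen_root k = \sum_(k | C k) gen_root k.
  rewrite [RHS]big_mkcond; apply: eq_bigr => k _.
  by case: (C k); rewrite ?rmorph1 ?mul1r // !rmorph0 mul0r.
by rewrite !S.
Qed.

Lemma gen_root_inj : injective gen_root.
Proof.
move=> i j eij; have := @gen_root_blocks (pred1 i) (pred1 j).
by rewrite !big_pred1_eq => /(_ eij i); rewrite !inE eqxx => /esym/eqP.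
Qed.

Lemma sum_gen_root : theta gen_root true + theta gen_root false = ratfun_const K 5 T.
Proof.
rewrite !theta_sum /= -[RHS]/(tofrac T%:MP) -sum_gen_coord rmorph_sum [RHS](bigID blk) /=.
by congr (_ + _); apply: eq_bigl => i; case: (blk i).
Qed.

Lemma gen_root_theta : theta gen_root true != theta gen_root false.
Proof.
rewrite !theta_sum; apply/eqP => /gen_root_blocks/(_ ord0).
by rewrite unfold_in /= => /esym/eqP.
Qed.

End GenericPoint.

Lemma subst_gen_coord (K : fieldType) (T : K) (s : 'S_6) i :
  mmap (@mpolyC 5 K) (fun j => gen_coord T (s (lift ord_max j))) (gen_coord T i)
  = gen_coord T (s i).
Proof.
have [j ->|->] := unliftP ord_max i; first by rewrite gen_coord_lift mmapX mmap1U.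
rewrite gen_coord_max rmorphB rmorph_sum /= mmapC /= -(sum_gen_coord T).
rewrite (reindex_inj (@perm_inj _ s)) (bigD1_ord ord_max) //=.
under [X in _ - X]eq_bigr do rewrite mmapX mmap1U.
by rewrite addrK.
Qed.

(** Permuting the generic roots is well defined because it preserves their only
    relation, that their sum is T. *)
Lemma gen_root_auto (K : fieldType) (T : K) (s : 'S_6) :
  exists phi : {rmorphism ratfun K 5 -> ratfun K 5},
    (forall c, phi (ratfun_const K 5 c) = ratfun_const K 5 c) /\
    (forall i, phi (gen_root T i) = gen_root T (s i)).
Proof.
pose S (t : 'S_6) : {rmorphism {mpoly K[5]} -> {mpoly K[5]}} :=
  mmap (@mpolyC 5 K) (fun j => gen_coord T (t (lift ord_max j))).
have SK t : cancel (S t) (S t^-1%g).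
  move=> p; rewrite -[RHS]/(idfun p).
  have /(_ p) : S t^-1%g \o S t =1 (idfun : {rmorphism {mpoly K[5]} -> {mpoly K[5]}}).
    apply: mpoly_morph_ext => [c|j] /=; first by rewrite /S !mmapC.
    by rewrite /S /= mmapX mmap1U subst_gen_coord permK gen_coord_lift.
  by [].
have inj : injective (@FracField.tofrac {mpoly K[5]} \o S s).
  by move=> x y /eqP /=; rewrite tofrac_eq => /eqP; apply: (can_inj (SK s)).
have [phi phiE] := frac_lift inj; exists phi; split=> [c|i].
  by rewrite phiE /= mmapC.
by rewrite phiE /= subst_gen_coord.
Qed.

(** * The Galois group over the rational function field *)

Section GenericGroup.
Variables (K : fieldType) (T : K) (q : 'I_5 -> ratfun K 5) (tau : 'I_5 -> {mpoly K[5]}).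
Hypothesis T_neq0 : T != 0.
Hypothesis tauK : forall i, mmap (ratfun_const K 5) q (tau i) = tofrac 'X_i.
Hypothesis q_disc : ratfun_const K 5 T ^+ 2 - 4 * q (inord 0) != 0.
Hypothesis qK : forall (L : fieldType) (iota : {rmorphism K -> L}) (v : 'I_5 -> L),
  iota T ^+ 2 - 4 * v (inord 0) != 0 ->
  forall k, value_at iota (fun i => mmap iota v (tau i)) (q k) (v k).

(** The values of the variables t_i at the generic roots. *)
Definition gen_t (i : 'I_5) : ratfun K 5 :=
  mmap (ratfun_const K 5) (params (gen_root T)) (tau i).

(** A relation P between the gen_t can be evaluated at the roots xi of
    wreath_poly T q in an extension M of K(t).  There gen_t takes the value
    tau(q) = t, so P(t) = 0 in M and P = 0. *)
Lemma gen_t_indep : injective (mmap (ratfun_const K 5) gen_t).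
Proof.
suff H P : mmap (ratfun_const K 5) gen_t P = 0 -> P = 0.
  by move=> P Q PQ; apply/eqP; rewrite -subr_eq0; apply/eqP/H; rewrite rmorphB /= PQ subrr.
move=> P0; have [M [i [xi [txi sxi vxi]]]] := wreath_poly_roots q_disc.
pose iM : {rmorphism K -> M} := i \o ratfun_const K 5.
pose lam j := xi (lift ord_max j).
have xE k : value_at iM lam (gen_root T k) (xi k).
  have [j ->|->] := unliftP ord_max k.
    by rewrite /gen_root gen_coord_lift; apply: value_at_X.
  rewrite /gen_root gen_coord_max rmorphB rmorph_sum /=.
  have -> : xi ord_max = iM T - \sum_j lam j.
    rewrite /iM /= -sxi !theta_sum.
    have -> : \sum_(k | blk k == true) xi k + \sum_(k | blk k == false) xi k = \sum_k xi k.
      by rewrite [RHS](bigID blk) /=; congr (_ + _); apply: eq_bigl => l; case: (blk l).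
    by rewrite (bigD1_ord ord_max) //= addrK.
  apply: value_atB; first exact: value_at_C.
  by apply: value_at_sum => j _; exact: value_at_X.
have tE j : value_at iM lam (gen_t j) (i (tofrac 'X_j)).
  rewrite -tauK morph_mmap -(eq_mmap (tau j) (fun c => erefl) vxi).
  by apply: value_at_mmap => // k; apply: value_at_params.
(* The relation P, evaluated at xi, becomes P(t). *)
have := value_at_mmap (k := ratfun_const K 5) P (fun c => erefl) tE.
rewrite P0 => /(value_at_uniq (value_at_nat _ _ 0)).
have -> : mmap iM (fun j => i (tofrac 'X_j)) P = i (tofrac P).
  have iX : (mmap iM (fun j => i (tofrac 'X_j)) : {mpoly K[5]} -> M) =1
            (i \o @FracField.tofrac {mpoly K[5]}).
    by apply: mpoly_morph_ext => [c|j]; rewrite /= ?mmapC // mmapX mmap1U.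
  exact: iX.
by move/esym/eqP; rewrite fmorph_eq0 tofrac_eq0 => /eqP.
Qed.

(** Substituting gen_t for t is injective, so it extends to K(t); by qK it sends
    the parameters q to those of the generic roots. *)
Lemma generic_embedding : exists j : {rmorphism ratfun K 5 -> ratfun K 5},
  [/\ forall p, j (tofrac p) = mmap (ratfun_const K 5) gen_t p &
      forall k, j (q k) = params (gen_root T) k].
Proof.
have [j jE] := frac_lift gen_t_indep.
exists j; split=> // k; apply: value_at_morph jE _.
apply: qK; rewrite -sum_gen_root.
have -> : params (gen_root T) (inord 0) =
    theta (gen_root T) true * theta (gen_root T) false.
  by rewrite /params /vec5 inordK.
by rewrite disc_theta gen_root_theta.
Qed.

Notation F := (ratfun K 5).
Notation E := (ratfun K 5).
Let g : {poly F} := wreath_poly (ratfun_const K 5 T) q.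
Notation x := (gen_root T).

(** K(t) embedded in E consists of elements invariant under G1, since the
    parameters of the generic roots do not change when these are permuted. *)
Lemma generic_roots : exists j : {rmorphism F -> E},
  [/\ j (ratfun_const K 5 T) = ratfun_const K 5 T, forall k, j (q k) = params x k,
      map_poly j g = \prod_i ('X - (x i)%:P)
    & forall s, block_perm s -> exists2 phi : {rmorphism E -> E},
        (forall i, phi (x i) = x (s i)) & (forall u, phi (j u) = j u)].
Proof.
have [j [jE jq]] := generic_embedding.
have jc c : j (ratfun_const K 5 c) = ratfun_const K 5 c by rewrite /= jE mmapC.
exists j; split=> //.
- rewrite /g map_wreath_poly (wreath_poly_ext _ jq).
  by rewrite prod_XsubC_wreath_poly ?gen_root_theta // sum_gen_root jc.
- move=> s bs; have [phi [phic phix]] := gen_root_auto T s; exists phi => // u.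
have : phi \o j =1 j; last by apply.
apply: frac_morph_ext => p /=; rewrite jE morph_mmap.
apply: eq_mmap => // i; rewrite /= /gen_t morph_mmap; apply: eq_mmap => // k /=.
have := @params_morph _ x _ phi k; rewrite [RHS]/= => <-.
by rewrite -(params_perm (gen_root_theta T_neq0) bs); apply: eq_params => l; exact: phix.
Qed.

Lemma generic_separable : separable_poly g.
Proof.
have [j [_ _ gE _]] := generic_roots.
rewrite -(separable_map j) gE -[index_enum _]enumT.
rewrite -(big_map x xpredT (fun z => 'X - z%:P)) separable_prod_XsubC.
rewrite map_inj_uniq ?enum_uniq //.
exact: gen_root_inj.
Qed.

(** The permutations in G1 act on the splitting field K(t)(x) inside E, which
    gives an injective morphism from G1 to the Galois group.  It is onto because
    an automorphism over K(t) sends theta to a root of the same quadratic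
    polynomial, that is to the sum of the roots in one of the two blocks. *)
Lemma generic_has_galois_group : has_galois_group g G1.
Proof.
have [j [jT jq gE aut]] := generic_roots.
have [N [e [al [eE eal gN cl]]]] := splitting_subfield gE.
have inje := fmorph_inj e.
have inj_al : injective al by move=> i k /(congr1 e); rewrite !eal => /gen_root_inj->.
exists N; split.
  exists [seq al i | i <- enum 'I_6]; first by rewrite gN big_map enumT eqpxx.
  exact: generated_full cl.
pose Gal := 'Gal({:N} / 1%VS)%g.
have Gal1 sg c : sg \in Gal -> sg c%:A = c%:A.
  by move=> sG; apply: (fixed_gal (sub1v _) sG); rewrite rpredZ // rpred1.
have Gal_eq sg tau' : sg \in Gal -> tau' \in Gal ->
    (forall i, sg (al i) = tau' (al i)) -> sg = tau'.
  move=> sG tG st; apply/eqP/gal_eqP => y _; move: y; apply: cl => // [c|y z|y z].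
  - by rewrite !Gal1.
  - by move=> Ey Ez; rewrite !rmorphD /= Ey Ez.
  - by move=> Ey Ez; rewrite !rmorphM /= Ey Ez.
have ex s : s \in G1 -> exists2 sg, sg \in Gal & forall i, sg (al i) = al (s i).
  rewrite G1E => /aut[phi phix phij].
  have [||sg sG sgE] := @extend_to_gal _ _ N e phi.
  - by move=> c; rewrite eE phij.
  - apply: cl => [c|y z [y' Ey] [z' Ez]|y z [y' Ey] [z' Ez]|i].
    + by exists c%:A; rewrite eE phij.
    + by exists (y' + z'); rewrite !rmorphD Ey Ez.
    + by exists (y' * z'); rewrite !rmorphM Ey Ez.
    + by exists (al (s i)); rewrite !eal phix.
  by exists sg => // i; apply: inje; rewrite sgE !eal phix.
pose f (s : 'S_6) : gal_of {:N} :=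
  odflt 1%g [pick sg in Gal | [forall i, sg (al i) == al (s i)]].
have fE s : s \in G1 -> f s \in Gal /\ forall i, f s (al i) = al (s i).
  move=> sG; rewrite /f; case: pickP => [sg /andP[gG /forallP h]|none] /=.
    by split=> // i; apply/eqP.
  have [sg gG gE'] := ex s sG; have := none sg; rewrite gG /=.
  by move/negbT/forallP => []; move=> i; apply/eqP.
have fM : {in G1 &, {morph f : s t / (s * t)%g}}.
  move=> s t sG tG; have [ss sE] := fE s sG; have [st tE] := fE t tG.
  have [sst stE] := fE (s * t)%g (groupM sG tG).
  apply: Gal_eq => // [|i]; first exact: groupM.
  by rewrite stE galM ?memvf // sE tE permM.
pose fm := Morphism fM.
have injf : ('injm fm)%g.
  apply/injmP => s t sG tG /= st; apply/permP => i; apply: inj_al.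
  by rewrite -(fE s sG).2 -(fE t tG).2 st.
have imf : (fm @* G1)%g = Gal.
  apply/eqP; rewrite eqEsubset; apply/andP; split; apply/subsetP => sg.
    by case/morphimP => s sG _ ->; exact: (fE s sG).1.
  move=> sG.
  have ext i : exists k, sg (al i) == al k.
    have : root (map_poly (in_alg N) g) (sg (al i)).
      have -> : map_poly (in_alg N) g = map_poly sg (map_poly (in_alg N) g).
        by rewrite -map_poly_comp; apply: eq_map_poly => c /=; rewrite Gal1.
      rewrite fmorph_root gN (bigD1 i) //= rootM root_XsubC eqxx //.
    rewrite gN -[index_enum _]enumT -(big_map al xpredT (fun z => 'X - z%:P)).
    by rewrite root_prod_XsubC => /mapP[k _ ->]; exists k.
  pose h i := xchoose (ext i).
  have hE i : sg (al i) = al (h i) by apply/eqP/(xchooseP (ext i)).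
  have hI : injective h.
    move=> i k e1; apply/inj_al/(fmorph_inj sg).
    exact: etrans (hE i) (etrans (congr1 al e1) (esym (hE k))).
  pose s := perm hI; have sE i : sg (al i) = al (s i) by rewrite permE.
  have sG1 : s \in G1.
    rewrite G1E; apply/block_permP.
    have eth b : e (theta al b) = theta x b.
      by rewrite -theta_morph !theta_sum; apply: eq_bigr => i _ /=; exact: eal.
    have sgth : sg (theta al true) = \sum_(i | blk ((s^-1)%g i)) al i.
      rewrite theta_sum rmorph_sum [RHS](reindex_inj (@perm_inj _ s)) /=.
      by apply: eq_big => [i|i _]; [rewrite permK; case: (blk i) | exact: sE].
    have sumT : theta al true + theta al false = (ratfun_const K 5 T)%:A.
      by apply: inje; rewrite rmorphD !eth sum_gen_root eE jT.
    have prodq : theta al true * theta al false = (q (inord 0))%:A.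
      by apply: inje; rewrite rmorphM !eth eE jq /params /vec5 inordK.
    (* Both theta are roots of the quadratic with coefficients T and q_0. *)
    have : (sg (theta al true) - theta al true) * (sg (theta al true) - theta al false) = 0.
      have -> : forall y t u : N, (y - t) * (y - u) = y * y - (t + u) * y + t * u.
        by move=> *; ring.
      rewrite sumT prodq -[in (_%:A * _)](Gal1 sg _ sG) -[(q _)%:A](Gal1 sg _ sG).
      rewrite -!rmorphM -rmorphB -rmorphD /= -sumT -prodq.
      by rewrite -[RHS](rmorph0 sg); congr (sg _); ring.
    move/eqP; rewrite mulf_eq0 !subr_eq0 sgth => /orP[] /eqP/(congr1 e).
    - rewrite eth theta_sum rmorph_sum (eq_bigr _ (fun i _ => eal i)).
      move/(gen_root_blocks T_neq0) => H; exists false => i; rewrite addbF.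
      by have := H (s i); rewrite !unfold_in permK => ->; case: (blk _).
    - rewrite eth theta_sum rmorph_sum (eq_bigr _ (fun i _ => eal i)).
      move/(gen_root_blocks T_neq0) => H; exists true => i; rewrite addbT.
      by have := H (s i); rewrite !unfold_in permK => ->; case: (blk _).
  apply/morphimP; exists s => //; apply: Gal_eq => // [|i]; first exact: (fE s sG1).1.
  by rewrite (fE s sG1).2.
by rewrite isog_sym; have := sub_isog (subxx G1) injf; rewrite imf.
Qed.

End GenericGroup.

(** * Extensions with group G1 *)

Section Realization.
Variables (L : fieldType) (N : splittingFieldType L).
Hypothesis galN : galois 1%VS {:N}%VS.
Notation Gal := 'Gal({:N} / 1%VS)%g.
Variable f : {morphism Gal >-> 'S_6}.
Hypothesis injf : ('injm f)%g.
Hypothesis imf : (f @* Gal)%g = G1.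

Let f_G1 s : s \in Gal -> f s \in G1.
Proof. by move=> sG; rewrite -imf mem_morphim. Qed.

Let G1_f t : t \in G1 -> exists2 s, s \in Gal & f s = t.
Proof. by rewrite -imf => /morphimP[s sG _ ->]; exists s. Qed.

Let f_block s : s \in Gal -> block_perm (f s).
Proof. by move/f_G1; rewrite G1E. Qed.

Definition equivariant (al : 'I_6 -> N) :=
  forall s, s \in Gal -> forall i, s (al i) = al (f s i).

(** The sum of the conjugates of y under the automorphisms that map the first
    point to i.  It is the trace of y to the fixed field of the stabiliser of
    the first point, and its conjugates. *)
Definition partial_trace (y : N) (i : 'I_6) : N :=
  \sum_(s in Gal | f s ord0 == i) s y.

Lemma partial_trace_equivariant y : equivariant (partial_trace y).
Proof.
move=> t tG i; rewrite /partial_trace rmorph_sum.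
rewrite [RHS](reindex_inj (mulIg t)) /=; apply: eq_big => [s|s /andP[sG _]].
  rewrite groupMr //; have [sG|//] := boolP (s \in Gal).
  by rewrite morphM // permM (inj_eq perm_inj).
by rewrite galM ?memvf.
Qed.

(** Dedekind independence of automorphisms: the partial traces are sums over
    disjoint sets of automorphisms, and the identity occurs for i = 0. *)
Lemma partial_trace_independent (w : 'I_6 -> N) : w ord0 != 0 ->
  exists y, \sum_i w i * partial_trace y i != 0.
Proof.
move=> w0; pose c (s : gal_of {:N}) := w (f s ord0).
have c1 : c 1%g != 0 by rewrite /c morph1 perm1.
have [y _ yn] := gal_independent_contra (group1 Gal) c1.
exists y; apply: contraNneq yn => yE; rewrite -[X in _ == X]yE.
rewrite (partition_big (fun s => f s ord0) xpredT) //=; apply/eqP.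
apply: eq_bigr => i _; rewrite /partial_trace mulr_sumr.
by apply: eq_bigr => s /andP[_ /eqP <-].
Qed.

Lemma theta_equivariant al : equivariant al ->
  forall s, s \in Gal -> forall b, s (theta al b) = theta al (b (+) swaps (f s)).
Proof.
move=> eal s sG b; rewrite -theta_perm ?f_block // -theta_morph !theta_sum.
by apply: eq_bigr => i _ /=; rewrite eal.
Qed.

(** A generator of the quadratic subextension with prescribed trace T.  Start
    from conjugate elements u_true and u_false that differ.  If their sum is
    nonzero, rescale them; otherwise 2 is invertible and T/2 may be added. *)
Lemma conjugate_pair (T : N) : T != 0 -> (forall s, s \in Gal -> s T = T) ->
  exists t : bool -> N, [/\ t true + t false = T, t true != t false &
    forall s, s \in Gal -> forall b, s (t b) = t (b (+) swaps (f s))].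
Proof.
move=> T0 fixT; pose w i : N := if blk i then 1 else -1.
have [|y] := @partial_trace_independent w; first by rewrite /w blk0 oner_neq0.
pose u := theta (partial_trace y).
have -> : \sum_i w i * partial_trace y i = u true - u false.
  rewrite /u !theta_sum (bigID blk) /= -sumrN; congr (_ + _); apply: eq_big => i; rewrite /w.
  - by case: (blk i).
  - by move=> ->; rewrite mul1r.
  - by case: (blk i).
  - by move=> /negbTE->; rewrite mulN1r.
rewrite subr_eq0 => utf.
have uE s : s \in Gal -> forall b, s (u b) = u (b (+) swaps (f s)).
  exact/theta_equivariant/partial_trace_equivariant.
have [u0|u0] := eqVneq (u true + u false) 0.
  have two : 2 != 0 :> N.
    apply: contraNneq utf => two0.
    have -> : u true = (u true + u false) - 2 * u false + u false by ring.
    by rewrite u0 two0 mul0r subr0 add0r.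
  exists (fun b => T / 2 + u b); split=> [||s sG b].
  - by rewrite addrACA u0 addr0; field.
  - by rewrite (inj_eq (addrI _)).
  - by rewrite rmorphD fmorph_div rmorph_nat /= fixT // uE.
exists (fun b => T * (u b / (u true + u false))); split=> [||s sG b].
- by field.
- by rewrite (inj_eq (mulfI T0)) (inj_eq (mulIf (invr_neq0 u0))).
- rewrite rmorphM fmorph_div rmorphD /= fixT // !uE //.
  by case: (swaps _) => //=; rewrite [u false + _]addrC.
Qed.

(** Dividing partial traces by their sum over the block gives a family g0 with
    block sums 1.  If its values at the first two points agree, correct it by a
    family R of partial traces that separates them: the family
    R_i + (1 - r) g0_i, with r the sum of R over the block of i, has block sums
    1, and the correction term takes the same value at these two points. *)
Lemma block_partition_of_unity : exists ga : 'I_6 -> N,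
  [/\ equivariant ga, forall b, theta ga b = 1 & ga ord0 != ga (inord 1)].
Proof.
have b1 : blk (inord 1) = true by rewrite /blk inordK.
pose w i : N := if blk i then 1 else 0.
have [|x] := @partial_trace_independent w; first by rewrite /w blk0 oner_neq0.
set S := partial_trace x; have eS : equivariant S := partial_trace_equivariant x.
have -> : \sum_i w i * S i = theta S true.
  rewrite theta_sum [RHS]big_mkcond; apply: eq_bigr => i _; rewrite /w.
  by case: (blk i); rewrite ?mul1r ?mul0r.
move=> St0; have S0 b : theta S b != 0.
  case: b => //; have [s sG sE] := G1_f swap_blocks_G1.
  rewrite -[false]/(true (+) true) -[X in true (+) X](_ : swaps (f s) = true).
    by rewrite -theta_equivariant // fmorph_eq0.
  by rewrite sE /swaps blk_swap_blocks negbK.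
pose g0 i := S i / theta S (blk i).
have eg0 : equivariant g0.
  move=> s sG i; rewrite fmorph_div /= eS // theta_equivariant //.
  by rewrite -blk_perm ?f_block.
have tg0 b : theta g0 b = 1.
  rewrite theta_sum; under eq_bigr => i /eqP bi do rewrite /g0 bi.
  by rewrite -mulr_suml -theta_sum divff.
have [g01|] := eqVneq (g0 ord0) (g0 (inord 1)); last by exists g0.
pose v (i : 'I_6) : N := (i == ord0)%:R - (i == inord 1)%:R.
have [|y] := @partial_trace_independent v.
  by rewrite /v eqxx -val_eqE /= inordK //= subr0 oner_neq0.
set R := partial_trace y; have eR : equivariant R := partial_trace_equivariant y.
have -> : \sum_i v i * R i = R ord0 - R (inord 1).
  under eq_bigr do rewrite /v mulrBl.
  rewrite sumrB; congr (_ - _);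
    by under eq_bigr do rewrite mulr_natl mulrb; rewrite -big_mkcond big_pred1_eq.
rewrite subr_eq0 => R01.
exists (fun i => R i + (1 - theta R (blk i)) * g0 i); split=> [s sG i|b|].
- rewrite rmorphD rmorphM rmorphB rmorph1 /= eR // eg0 // theta_equivariant //.
  by rewrite -blk_perm ?f_block.
- rewrite theta_sum big_split /=; under [X in _ + X]eq_bigr => i /eqP bi do rewrite bi.
  by rewrite -mulr_sumr -!theta_sum tg0 mulr1 addrC subrK.
- by rewrite b1 blk0 -g01 (inj_eq (addIr _)).
Qed.

Lemma realize_roots (T : L) : T != 0 -> exists al : 'I_6 -> N,
  [/\ equivariant al, theta al true + theta al false = T%:A, theta al true != theta al false
    & al ord0 != al (inord 1)].
Proof.
move=> T0; have fixT s : s \in Gal -> s (T%:A) = T%:A.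
  by move=> sG; apply: (fixed_gal (sub1v _) sG); rewrite rpredZ // rpred1.
have TA0 : T%:A != 0 :> N by rewrite -[T%:A]/(in_alg N T) fmorph_eq0.
have [t [tT tn tE]] := conjugate_pair TA0 fixT.
have [ga [ega tga ga01]] := block_partition_of_unity.
pose al i := t (blk i) * ga i.
have tal b : theta al b = t b.
  rewrite theta_sum; under eq_bigr => i /eqP bi do rewrite /al bi.
  by rewrite -mulr_sumr -theta_sum tga mulr1.
exists al; split; rewrite ?tal //.
- by move=> s sG i; rewrite rmorphM /= ega // tE // -blk_perm ?f_block.
- have [s sG sE] := G1_f swap_blocks_G1.
  have b1 : blk (inord 1) = true by rewrite /blk inordK.
  rewrite /al blk0 b1 (inj_eq (mulfI _)) //.
  apply: contraNneq TA0 => t0; have := tE s sG true.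
  by rewrite -tT t0 rmorph0 sE /swaps blk_swap_blocks blk0 /= => <-; rewrite addr0.
Qed.

(** The parameters of the sextic with roots al are invariant, hence lie in L.
    An automorphism that fixes every al_i cannot exchange the blocks, as the
    two values of theta differ.  It cannot move a point inside a block either,
    as al is injective on each block by double transitivity.  It is therefore
    trivial, so that the al_i generate N. *)
Lemma realize (T : L) : T != 0 -> exists v : 'I_5 -> L,
  T ^+ 2 - 4 * v (inord 0) != 0 /\
  splittingFieldFor 1 (map_poly (in_alg N) (wreath_poly T v)) {:N}.
Proof.
move=> /realize_roots[al [eal alT tn al01]].
have paramsL k : exists c : L, params al k = c%:A.
  suff : params al k \in 1%VS by case/vlineP => c; exists c.
  rewrite -(galois_fixedField galN); apply/fixedFieldP; rewrite ?memvf // => s sG.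
  have := @params_morph _ al _ s k; rewrite [RHS]/= => <-.
  rewrite -(params_perm tn (f_block sG)); apply: eq_params => i /=.
  exact: eal.
have [v vE] := fin_all_exists paramsL.
have n_eq : theta al true * theta al false = (v (inord 0))%:A.
  by rewrite -vE /params /vec5 inordK.
exists v; split.
  rewrite -(fmorph_eq0 (in_alg N)) rmorphB rmorphXn rmorphM rmorph_nat /=.
  by rewrite -alT -n_eq disc_theta.
exists [seq al i | i <- enum 'I_6].
  rewrite map_wreath_poly /= -alT -(wreath_poly_ext _ vE) -prod_XsubC_wreath_poly //.
  by rewrite big_map enumT eqpxx.
pose K : {subfield N} := <<1 & [seq al i | i <- enum 'I_6]>>%AS.
suff : (K : {vspace N}) = {:N}%VS by [].

have alK i : al i \in K by apply: seqv_sub_adjoin; rewrite map_f ?mem_enum.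
have sK : (1 <= K)%VS by apply: sub1v.
have GK s : s \in 'Gal({:N} / K)%g -> s = 1%g.
  move=> sGK; have sG : s \in Gal by apply: subsetP sGK; apply: galS.
  have als i : al (f s i) = al i.
    by rewrite -eal // (fixed_gal (subvf K) sGK).
  have nsw : swaps (f s) = false.
    apply: contraNF tn => sw; have := theta_equivariant eal sG true.
    rewrite sw /= => <-; rewrite -theta_morph !theta_sum.
    by apply/eqP; apply: eq_bigr => i _ /=; rewrite eal.
  apply: (injmP injf) => //; rewrite morph1; apply/permP => i; rewrite perm1.
  apply/eqP/idPn => ni; have [|t tG1 [t0 t1]] := G1_2trans ni.
    by rewrite blk_perm ?f_block // nsw addbF.
  have [r rG rE] := G1_f tG1.
  have /eqP := als i; rewrite -t0 -t1 -rE -!eal //.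
  by rewrite (inj_eq (fmorph_inj r)) (negbTE al01).
have gK : galois K {:N} by apply: galoisS galN; rewrite sK subvf.
apply/eqP; rewrite eqEsubv subvf /= -(galois_fixedField gK).
apply/subvP => y _; apply/fixedFieldP; rewrite ?memvf // => s /GK ->.
by rewrite gal_id.
Qed.
End Realization.

(** * Generic polynomials *)

(** The hypotheses on q and tau say that they are inverse to each other: tau
    gives the variables t as polynomials in the parameters, and q gives the
    parameters as rational functions of t, defined wherever the discriminant
    T^2 - 4n does not vanish. *)
Lemma wreath_poly_generic (K : fieldType) (T : K) (q : 'I_5 -> ratfun K 5)
    (tau : 'I_5 -> {mpoly K[5]}) :
  T != 0 ->
  (forall i, mmap (ratfun_const K 5) q (tau i) = tofrac 'X_i) ->
  ratfun_const K 5 T ^+ 2 - 4 * q (inord 0) != 0 ->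
  (forall (L : fieldType) (iota : {rmorphism K -> L}) (v : 'I_5 -> L),
     iota T ^+ 2 - 4 * v (inord 0) != 0 ->
     forall k, value_at iota (fun i => mmap iota v (tau i)) (q k) (v k)) ->
  generic_polynomial (wreath_poly (ratfun_const K 5 T) q) G1.
Proof.
move=> T0 tauK qd qK; split.
- exact: wreath_poly_monic.
- exact: generic_separable tauK qd qK.
- exact: generic_has_galois_group tauK qd qK.
move=> L iota _ N galN /isogP[f injf imf].
have iT0 : iota T != 0 by rewrite fmorph_eq0.
have [v [disc splitN]] := realize galN injf imf iT0.
exists (fun i => mmap iota v (tau i)), (wreath_poly (iota T) v); split=> //.
apply: value_at_wreath_poly; last exact: qK.
exact: value_at_C.
Qed.

Lemma wreath_poly_vec5 (R : nzRingType) (T n a b c d : R) :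
  wreath_poly T (vec5 n a b c d) = Poly (wreath_coefs T n a b c d).
Proof. by rewrite /wreath_poly /vec5 !inordK. Qed.

Lemma wreath_poly_char2 (R : comNzRingType) (t1 t2 t3 t4 t5 : R) : 2 = 0 :> R ->
  'X^6 + 'X^5 + (t1 + t3) *: 'X^4 + (t2 + t4) *: 'X^3
  + (t5 + t3 * t1 ^+ 2 + t1 * t4 + t4 ^+ 2) *: 'X^2
  + (t1 * t5 + t4 * t2) *: 'X + (t3 * t2 ^+ 2 + t2 * t5 + t5 ^+ 2)%:P
  = wreath_poly 1 (vec5 t3 t1 t4 t2 t5).
Proof.
move=> two0; have NE (u : R) : - u = u.
  by apply/eqP; rewrite -subr_eq0 -opprD oppr_eq0 -mulr2n -mulr_natl two0 mul0r.
rewrite wreath_poly_vec5 /wreath_coefs [- 1]NE [- (_ + _)]NE [- (_ + _)]NE two0 /=.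
rewrite !cons_poly_def -!mul_polyC.
rewrite !(polyCD, polyCN, polyCM, polyCB, rmorphXn, polyC1, polyC0, polyC_natr) /=.
ring.
Qed.

Lemma wreath_poly_char_neq2 (F : fieldType) (t1 t2 t3 t4 t5 : F) : t3 != 0 ->
  'X^6 - 2 *: 'X^5 + (2 * t1 + t3 + 1) *: 'X^4 - (2 * t2 + 2 * t4) *: 'X^3
  + (2 * t5 + t1 ^+ 2 + (t1 - t4) ^+ 2 / t3) *: 'X^2
  - (2 * (t1 * t2 + (t1 - t4) * (t2 - t5) / t3)) *: 'X
  + (t2 ^+ 2 + (t2 - t5) ^+ 2 / t3)%:P
  = wreath_poly 2 (vec5 (1 + t3) ((t4 - t1) / t3) (t1 - (t4 - t1) / t3)
                  ((t5 - t2) / t3) (t2 - (t5 - t2) / t3)).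
Proof.
move=> t30; rewrite wreath_poly_vec5; apply/polyP => i; rewrite coef_Poly.
rewrite !(coefB, coefD, coefZ, coefXn, coefX, coefC, coefN) /wreath_coefs.
do 7?[case: i => [|i] /=]; try by field.
by rewrite nth_nil; ring.
Qed.

Section Instances.
Variable K : fieldType.
Notation t := (tvar K).

Lemma tvarE k : t k.+1 = tofrac 'X_(inord k). Proof. by []. Qed.

Definition mvar k : {mpoly K[5]} := 'X_(inord k).

Lemma mmap_mvar (A : comNzRingType) (k : {rmorphism K -> A}) (v : 'I_5 -> A) i :
  mmap k v (mvar i) = v (inord i).
Proof. by rewrite mmapX mmap1U. Qed.

Lemma ord5_ind (P : 'I_5 -> Prop) :
  P (inord 0) -> P (inord 1) -> P (inord 2) -> P (inord 3) -> P (inord 4) ->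
  forall k, P k.
Proof.
move=> P0 P1 P2 P3 P4 k; rewrite -[k]inord_val; case: k => k /=.
by do 5?[case: k => [|k] //].
Qed.

Lemma vec5_inord (R : nmodType) (n a b c d : R) :
  [/\ vec5 n a b c d (inord 0) = n, vec5 n a b c d (inord 1) = a,
      vec5 n a b c d (inord 2) = b, vec5 n a b c d (inord 3) = c
    & vec5 n a b c d (inord 4) = d].
Proof. by rewrite /vec5 !inordK. Qed.

Lemma tvar_neq0 k : t k.+1 != 0.
Proof.
rewrite tvarE tofrac_eq0; apply/eqP => /(congr1 (mcoeff U_(inord k)%MM)).
by rewrite mcoeffXU eqxx mcoeff0 => /eqP; rewrite oner_eq0.
Qed.

(** With T = 1 and n = t_3, theta is a root of Y^2 + Y + t_3: the quadratic
    extension is given in Artin-Schreier form. *)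
Definition q_char2 := vec5 (t 3) (t 1) (t 4) (t 2) (t 5).
Definition tau_char2 := vec5 (mvar 1) (mvar 3) (mvar 0) (mvar 2) (mvar 4).

Lemma generic_char2 : 2 \in [pchar K] -> generic_polynomial (poly_char2 K) G1.
Proof.
move=> ch2; have two0 : 2 = 0 :> ratfun K 5.
  by rewrite -(rmorph_nat (ratfun_const K 5)) (pcharf0 ch2) rmorph0.
have four0 (R : pzRingType) : 2 = 0 :> R -> 4 = 0 :> R.
  move=> z; have -> : 4 = 2 * 2 :> R by rewrite -natrM.
  by rewrite z mul0r.
have [q20 q21 q22 q23 q24] := vec5_inord (t 3) (t 1) (t 4) (t 2) (t 5).
have [e0 e1 e2 e3 e4] := vec5_inord (mvar 1) (mvar 3) (mvar 0) (mvar 2) (mvar 4).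
rewrite /poly_char2 wreath_poly_char2 // -(rmorph1 (ratfun_const K 5)) -/q_char2.
apply: (@wreath_poly_generic _ 1 q_char2 tau_char2); rewrite ?oner_neq0 //.
- apply: ord5_ind; rewrite /tau_char2 ?e0 ?e1 ?e2 ?e3 ?e4 mmap_mvar
    /q_char2 ?q20 ?q21 ?q22 ?q23 ?q24 tvarE //.
- by rewrite (four0 _ two0) mul0r subr0 rmorph1 expr1n oner_neq0.
- move=> L iota v _; apply: ord5_ind; rewrite /q_char2 ?q20 ?q21 ?q22 ?q23 ?q24 tvarE.
  all: set lam := (fun i => _).
  + by have := value_at_X iota lam (inord 2); rewrite /lam /tau_char2 e2 mmap_mvar.
  + by have := value_at_X iota lam (inord 0); rewrite /lam /tau_char2 e0 mmap_mvar.
  + by have := value_at_X iota lam (inord 3); rewrite /lam /tau_char2 e3 mmap_mvar.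
  + by have := value_at_X iota lam (inord 1); rewrite /lam /tau_char2 e1 mmap_mvar.
  + by have := value_at_X iota lam (inord 4); rewrite /lam /tau_char2 e4 mmap_mvar.
Qed.

(** Here n = 1 + t_3, and a, c are the coordinates on theta; b and d then follow
    from t_1 = a + b and t_2 = c + d.  The denominator t_3 = n - 1 is, up to the
    factor -4, the discriminant 2^2 - 4n. *)
Definition q_neq2 := vec5 (1 + t 3) ((t 4 - t 1) / t 3) (t 1 - (t 4 - t 1) / t 3)
                      ((t 5 - t 2) / t 3) (t 2 - (t 5 - t 2) / t 3).
Definition tau_neq2 := vec5 (mvar 1 + mvar 2) (mvar 3 + mvar 4) (mvar 0 - 1)
     (mvar 1 * mvar 0 + mvar 2) (mvar 3 * mvar 0 + mvar 4).

Lemma mmap_tau_neq2 (A : comNzRingType) (k : {rmorphism K -> A}) (v : 'I_5 -> A) :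
  [/\ mmap k v (tau_neq2 (inord 0)) = v (inord 1) + v (inord 2),
      mmap k v (tau_neq2 (inord 1)) = v (inord 3) + v (inord 4),
      mmap k v (tau_neq2 (inord 2)) = v (inord 0) - 1,
      mmap k v (tau_neq2 (inord 3)) = v (inord 1) * v (inord 0) + v (inord 2)
    & mmap k v (tau_neq2 (inord 4)) = v (inord 3) * v (inord 0) + v (inord 4)].
Proof.
have [e0 e1 e2 e3 e4] := vec5_inord (mvar 1 + mvar 2) (mvar 3 + mvar 4) (mvar 0 - 1)
     (mvar 1 * mvar 0 + mvar 2) (mvar 3 * mvar 0 + mvar 4).
rewrite /tau_neq2 e0 e1 e2 e3 e4 !mmapD !mmapN !rmorphM rmorph1 /=.
by rewrite !mmap_mvar.
Qed.

Lemma q_tau_neq2 (F : fieldType) (t1 t2 t3 t4 t5 : F) : t3 != 0 ->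
  let n := 1 + t3 in let a := (t4 - t1) / t3 in let b := t1 - a in
  let c := (t5 - t2) / t3 in let d := t2 - c in
  [/\ a + b = t1, c + d = t2, n - 1 = t3, a * n + b = t4 & c * n + d = t5].
Proof. by move=> t30; split; rewrite /=; field. Qed.

Lemma tau_q_neq2 (F : fieldType) (n a b c d : F) : n - 1 != 0 ->
  let t1 := a + b in let t2 := c + d in let t3 := n - 1 in
  let t4 := a * n + b in let t5 := c * n + d in
  [/\ n = 1 + t3, a = (t4 - t1) / t3, b = t1 - (t4 - t1) / t3, c = (t5 - t2) / t3
    & d = t2 - (t5 - t2) / t3].
Proof. by move=> n1; split; rewrite /=; field. Qed.

Lemma generic_char_neq2 : 2 \notin [pchar K] -> generic_polynomial (poly_char_neq2 K) G1.
Proof.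
move=> ch2; have two_neq0 (A : fieldType) (h : {rmorphism K -> A}) : 2 != 0 :> A.
  by rewrite -(rmorph_nat h) fmorph_eq0; apply: contra ch2 => two0; rewrite inE /= two0.
have disc0 (A : fieldType) (n : A) : (2 : A) ^+ 2 - 4 * n = - (2 * 2 * (n - 1)) by ring.
have t3 := tvar_neq0 2.
have [q0E q1E q2E q3E q4E] := vec5_inord (1 + t 3) ((t 4 - t 1) / t 3)
  (t 1 - (t 4 - t 1) / t 3) ((t 5 - t 2) / t 3) (t 2 - (t 5 - t 2) / t 3).
rewrite /poly_char_neq2 wreath_poly_char_neq2 // -{1}(rmorph_nat (ratfun_const K 5)) -/q_neq2.
apply: (@wreath_poly_generic _ 2 q_neq2 tau_neq2); first exact: two_neq0 idfun.
- have [e0 e1 e2 e3 e4] := mmap_tau_neq2 (ratfun_const K 5) q_neq2.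
  have [f0 f1 f2 f3 f4] := q_tau_neq2 (t 1) (t 2) (t 4) (t 5) t3.
  by apply: ord5_ind; rewrite ?e0 ?e1 ?e2 ?e3 ?e4 /q_neq2 ?q0E ?q1E ?q2E ?q3E ?q4E.
- rewrite rmorph_nat disc0 /q_neq2 q0E oppr_eq0 addrC addrA addNr add0r.
  by apply: mulf_neq0 t3; apply: mulf_neq0; exact: two_neq0 (ratfun_const K 5).
move=> L iota v; rewrite rmorph_nat disc0 oppr_eq0.
rewrite !mulf_eq0 (negbTE (two_neq0 _ iota)) /= => n1.
set lam := (fun i => _).
have tE k : value_at iota lam (t k.+1) (lam (inord k)) by exact: value_at_X.
have [l0 l1 l2 l3 l4] := mmap_tau_neq2 iota v.
have V1 := tE 0; rewrite [lam _]l0 in V1; have V2 := tE 1; rewrite [lam _]l1 in V2.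
have V3 := tE 2; rewrite [lam _]l2 in V3; have V4 := tE 3; rewrite [lam _]l3 in V4.
have V5 := tE 4; rewrite [lam _]l4 in V5.
have [n_eq a_eq b_eq c_eq d_eq] :=
  tau_q_neq2 (v (inord 1)) (v (inord 2)) (v (inord 3)) (v (inord 4)) n1.
have Va := value_at_div n1 (value_atB V4 V1) V3.
have Vc := value_at_div n1 (value_atB V5 V2) V3.
apply: ord5_ind; rewrite /q_neq2 ?q0E ?q1E ?q2E ?q3E ?q4E.
- by rewrite [v _]n_eq; exact: value_atD (value_at_nat _ _ 1) V3.
- by rewrite [v _]a_eq.
- by rewrite [v _]b_eq; exact: value_atB V1 Va.
- by rewrite [v _]c_eq.
- by rewrite [v _]d_eq; exact: value_atB V2 Vc.
Qed.
End Instances.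

Local Close Scope ring_scope.

Theorem mainTheorem3 (K : fieldType) :
  (2 \in [pchar K]%R -> generic_polynomial (poly_char2 K) G1)
  /\ (2 \notin [pchar K]%R -> generic_polynomial (poly_char_neq2 K) G1).
Proof. by split; [exact: generic_char2 | exact: generic_char_neq2]. Qed.
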